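(* Let $A$ be a (not necessarily unital) C*-algebra and let $B$ be a C*-subalgebra of $A$. If $\phi$ is a state of $B$ such that $A$ is $B$-compressible modulo $\phi$, then $\phi$ has a unique state extension to $A$. If $\phi$ is a pure state, then so is its unique extension.
   Context: Let $B$ be a C*-subalgebra of a C*-algebra $A$ and let $\phi$ be a state of $B$. Write $\mathcal{U}_\phi=\{b\in B:|\phi(b)|=\|b\|=1\}$. We say that $A$ is $B$-compressible modulo $\phi$ if for each $a\in A$ and $\epsilon>0$ there exist $b\in\mathcal{U}_\phi$ and $c\in B$ such that $b\ge 0$ and $\|bab-c\|<\epsilon$. A state is a positive linear functional of norm $1$. No unitality is assumed. *)

(* Defs.v *)
From HB Require Import structures.
From mathcomp Require Import all_boot all_order all_algebra.
From mathcomp Require Import complex.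
From mathcomp Require Import all_classical all_reals all_analysis.

Set Implicit Arguments.
Unset Strict Implicit.
Unset Printing Implicit Defensive.

Import Order.TTheory GRing.Theory Num.Theory.
Import numFieldNormedType.Exports.

Local Open Scope classical_set_scope.
Local Open Scope ring_scope.

(* Not necessarily unital: MathComp's algebra structures all have a 1, so the
   product is introduced here on top of a complex Banach space.  Norms take
   their (real, nonnegative) values in R[i]. *)
HB.mixin Record isCStarAlgebra (R : realType) A
    & CompleteNormedModule R[i] A := {
  cmul : A -> A -> A;
  star : A -> A;
  cmulA : associative cmul;
  cmulDl : left_distributive cmul +%R;
  cmulDr : right_distributive cmul +%R;
  cmulZl : forall (k : R[i]) (x y : A), cmul (k *: x) y = k *: cmul x y;
  cmulZr : forall (k : R[i]) (x y : A), cmul x (k *: y) = k *: cmul x y;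
  starD : {morph star : x y / x + y};
  starZ : forall (k : R[i]) (x : A), star (k *: x) = k^* *: star x;
  starM : forall x y : A, star (cmul x y) = cmul (star y) (star x);
  starK : involutive star;
  norm_cmul_le : forall x y : A, `|cmul x y| <= `|x| * `|y|;
  norm_star_cmul : forall x : A, `|cmul (star x) x| = `|x| ^+ 2
}.

#[short(type="cstarAlgType")]
HB.structure Definition CStarAlgebra (R : realType) :=
  {A of CompleteNormedModule R[i] A & isCStarAlgebra R A}.

Notation "x ** y" := (cmul x y) (at level 40, left associativity).

Record cstarSubalg (R : realType) (A : cstarAlgType R) := CStarSubalg {
  subalg_set : set A;
  subalg0 : subalg_set 0;
  subalgD : forall x y, subalg_set x -> subalg_set y -> subalg_set (x + y);
  subalgZ : forall (k : R[i]) x, subalg_set x -> subalg_set (k *: x);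
  subalgM : forall x y, subalg_set x -> subalg_set y -> subalg_set (x ** y);
  subalg_star : forall x, subalg_set x -> subalg_set (star x);
  subalg_closed : closed subalg_set
}.

Section SubalgType.
Context (R : realType) (A : cstarAlgType R) (B : cstarSubalg A).

Definition subalg_pred : {pred A} := fun x => x \in subalg_set B.

Fact subalg_predP x : reflect (subalg_set B x) (x \in subalg_pred).
Proof. by rewrite unfold_in; apply: (iffP idP); rewrite inE. Qed.

Definition subalg_submod_closed : submod_closed subalg_pred.
Proof.
split; first exact/subalg_predP/subalg0.
move=> k x y /subalg_predP Bx /subalg_predP By.
by apply/subalg_predP/subalgD => //; exact: subalgZ.
Qed.

HB.instance Definition _ :=
  GRing.isSubmodClosed.Build R[i] A subalg_pred subalg_submod_closed.

Definition subalg_type : Type := {x : A | x \in subalg_pred}.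

HB.instance Definition _ := [isSub of subalg_type for @sval A _].
HB.instance Definition _ := [Choice of subalg_type by <:].
HB.instance Definition _ := [SubChoice_isSubLmodule of subalg_type by <:].

Fact subalg_normD (x y : subalg_type) : `|\val (x + y)| <= `|\val x| + `|\val y|.
Proof. by rewrite raddfD; exact: ler_normD. Qed.
Fact subalg_normZ (k : R[i]) (x : subalg_type) :
  `|\val (k *: x)| = `|k| * `|\val x|.
Proof. by rewrite linearZ /= normrZ. Qed.
Fact subalg_norm0_eq0 (x : subalg_type) : `|\val x| = 0 -> x = 0.
Proof. by move=> /normr0_eq0 x0; apply: val_inj; rewrite x0 raddf0. Qed.

HB.instance Definition _ := Lmodule_isNormed.Build R[i] subalg_type
  subalg_normD subalg_normZ subalg_norm0_eq0.

Lemma norm_subalg_val (x : subalg_type) : `|\val x| = `|x|.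
Proof. by []. Qed.

Fact subalg_valP (x : subalg_type) : subalg_set B (\val x).
Proof. exact/subalg_predP/(valP x). Qed.

Definition subalg_sub (x : A) (Bx : subalg_set B x) : subalg_type :=
  exist _ x (introT (subalg_predP x) Bx).

Fact subalg_complete (F : set_system subalg_type) :
  ProperFilter F -> cauchy F -> cvg F.
Proof.
move=> FF /cauchy_ballP Fc.
have /cauchy_cvgP /cvg_ex[/= l Fl] : cauchy ((\val : subalg_type -> A) @ F).
  apply/cauchy_ballP => e e0; have := Fc e e0; rewrite !near_simpl => H.
  rewrite near_map2; apply: filterS H => -[x y] /=.
  by rewrite -!ball_normE /= -norm_subalg_val raddfB.
have Bl : subalg_set B l.
  apply: (@closed_cvg _ _ F _ (\val : subalg_type -> A)) => //.
  - exact: subalg_closed.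
  - by apply: nearW => x; exact: subalg_valP.
apply/cvg_ex; exists (subalg_sub Bl); apply/cvgrPdist_lt => e e0.
move/cvgrPdist_lt: Fl => /(_ e e0); apply: filterS => x /=.
by rewrite -norm_subalg_val raddfB.
Qed.

HB.instance Definition _ := Uniform_isComplete.Build subalg_type subalg_complete.

Definition subalg_mul (x y : subalg_type) : subalg_type :=
  subalg_sub (subalgM (subalg_valP x) (subalg_valP y)).
Definition subalg_st (x : subalg_type) : subalg_type :=
  subalg_sub (subalg_star (subalg_valP x)).

Fact subalg_mulA : associative subalg_mul.
Proof. by move=> x y z; apply: val_inj; exact: cmulA. Qed.
Fact subalg_mulDl : left_distributive subalg_mul +%R.
Proof. by move=> x y z; apply: val_inj; exact: cmulDl. Qed.
Fact subalg_mulDr : right_distributive subalg_mul +%R.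
Proof. by move=> x y z; apply: val_inj; exact: cmulDr. Qed.
Fact subalg_mulZl (k : R[i]) x y : subalg_mul (k *: x) y = k *: subalg_mul x y.
Proof. by apply: val_inj; exact: cmulZl. Qed.
Fact subalg_mulZr (k : R[i]) x y : subalg_mul x (k *: y) = k *: subalg_mul x y.
Proof. by apply: val_inj; exact: cmulZr. Qed.
Fact subalg_stD : {morph subalg_st : x y / x + y}.
Proof. by move=> x y; apply: val_inj; exact: starD. Qed.
Fact subalg_stZ (k : R[i]) x : subalg_st (k *: x) = k^* *: subalg_st x.
Proof. by apply: val_inj; exact: starZ. Qed.
Fact subalg_stM x y :
  subalg_st (subalg_mul x y) = subalg_mul (subalg_st y) (subalg_st x).
Proof. by apply: val_inj; exact: starM. Qed.
Fact subalg_stK : involutive subalg_st.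
Proof. by move=> x; apply: val_inj; exact: starK. Qed.
Fact subalg_norm_mul_le x y : `|subalg_mul x y| <= `|x| * `|y|.
Proof. exact: (norm_cmul_le (\val x) (\val y)). Qed.
Fact subalg_norm_st_mul x : `|subalg_mul (subalg_st x) x| = `|x| ^+ 2.
Proof. exact: (norm_star_cmul (\val x)). Qed.

HB.instance Definition _ := isCStarAlgebra.Build R subalg_type
  subalg_mulA subalg_mulDl subalg_mulDr subalg_mulZl subalg_mulZr
  subalg_stD subalg_stZ subalg_stM subalg_stK
  subalg_norm_mul_le subalg_norm_st_mul.

End SubalgType.

Section States.
Context (R : realType).
Implicit Type A : cstarAlgType R.

Definition positive_elt A (x : A) := exists y : A, x = star y ** y.

Definition positive_fun A (f : A -> R[i]) :=
  forall x : A, positive_elt x -> 0 <= f x.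

(* Operator norm, +oo for an unbounded functional; [complex.Re] only retypes
   the modulus, which is real, from R[i] to R. *)
Definition fun_norm A (f : A -> R[i]) : \bar R :=
  ereal_sup [set (complex.Re `|f x|)%:E | x in [set x : A | `|x| <= 1]].

Definition state A (f : A -> R[i]) :=
  [/\ scalar f, positive_fun f & fun_norm f = 1%E].

(* Extreme point of the convex set of states. *)
Definition pure_state A (f : A -> R[i]) :=
  state f /\
  forall (g h : A -> R[i]) (t : R), state g -> state h -> 0 < t < 1 ->
    (forall x, f x = t%:C%C * g x + (1 - t)%:C%C * h x) -> g = f /\ h = f.

Definition norming_set A (f : A -> R[i]) : set A :=
  [set b | `|f b| = 1 /\ `|b| = 1].

Definition compressible_modulo A (B : cstarSubalg A)
    (phi : subalg_type B -> R[i]) :=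
  forall (a : A) (eps : R), 0 < eps ->
    exists b c : subalg_type B,
      [/\ norming_set phi b, positive_elt b
        & `|\val b ** a ** \val b - \val c| < eps%:C%C].

Definition state_extension A (B : cstarSubalg A)
    (phi : subalg_type B -> R[i]) (psi : A -> R[i]) :=
  state psi /\ forall b : subalg_type B, psi (\val b) = phi b.

End States.

(* Main.v *)
Require Import Defs.
From Stdlib Require Ncring Ncring_tac.
From HB Require Import structures.
From mathcomp Require Import all_boot all_order all_algebra.
From mathcomp Require Import complex ring lra.
From mathcomp Require Import all_classical all_reals all_analysis.

(** Say that (f, c) compresses a up to s when f in B is positive of norm at most
    1, phi f = 1 and |f a f - c| <= s.  Given compressions by f1 and f2, put
    e = (f1 + f2) / 2: the Cesaro means f of the powers of e still satisfy
    phi f = 1, and (1 - f1) f and (1 - f2) f are small because (1 - e) f is.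
    Hence a1 and a2 can be compressed by the same f, and
    phi (f c f) = phi c shows that phi c converges, as s tends to 0, to a
    contractive linear extension of phi; this replaces the Hahn-Banach theorem.
    A contractive linear functional equal to 1 at some positive e of norm at
    most 1 is positive and satisfies psi (e a e) = psi a.  The first fact makes
    the extension a state, the second gives uniqueness; if the extension is a
    convex combination of states, these restrict to states of B, hence to phi
    when phi is pure, and uniqueness applies to them.

    The order on A is handled in the unitization, with x >= 0 meaning
    |r - x| <= r for some r >= 0.  Approximate square roots (from the iteration
    q |-> (m + q^2) / 2) and nearly unitary elements h + i k replace the
    functional calculus. *)

Set Implicit Arguments.
Unset Strict Implicit.
Unset Printing Implicit Defensive.

Import Order.TTheory GRing.Theory Num.Theory.
Import numFieldNormedType.Exports.

Local Open Scope classical_set_scope.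
Local Open Scope ring_scope.

Local Notation "r %:C" := (real_complex _ r) : ring_scope.

(** * Noncommutative ring identities *)

Section NoncommutativeRing.
Variable U : nzRingType.

#[global] Instance nzRing_ops : @Ncring.Ring_ops U 0%R 1%R +%R *%R
  (fun x y => x - y)%R (@GRing.opp U) (@eq U). Defined.

#[global] Instance nzRing_ncring : @Ncring.Ring U _ _ _ _ _ _ _ nzRing_ops.
Proof.
split.
- exact: RelationClasses.eq_equivalence.
- by move=> x y -> a b ->.
- by move=> x y -> a b ->.
- by move=> x y -> a b ->.
- by move=> x y ->.
- exact: add0r.
- exact: addrC.
- exact: addrA.
- exact: mul1r.
- exact: mulr1.
- exact: mulrA.
- exact: mulrDl.
- by move=> x y z; exact: mulrDr.
- by [].
- exact: subrr.
Qed.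

End NoncommutativeRing.

(* [Ncring] reifies its own equality class, hence the [change]. *)
Ltac ncring :=
  rewrite ?expr2 ?mulr2n;
  match goal with |- @eq ?T ?a ?b =>
    change (@Algebra_syntax.equality T (@Ncring.eq_notation T _ _ _ _ _ _ _ _) a b)
  end; Ncring_tac.non_commutative_ring.

(** * Real-valued modulus of complex numbers *)

Section ComplexModulus.
Variable R : realType.
Implicit Types (z w : R[i]) (r : R).

Definition cabs z : R := complex.Re `|z|.

Lemma cabsE z : `|z| = (cabs z)%:C.
Proof. by rewrite /cabs RRe_real // normr_real. Qed.

Lemma cabs_real r : cabs r%:C = `|r|.
Proof. by rewrite /cabs normc_def /= expr0n addr0 sqrtr_sqr. Qed.

Lemma conj_real_complex r : (r%:C : R[i])^* = r%:C.
Proof. by apply: conj_Creal; rewrite complex_real. Qed.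

Lemma cabs_ge0 z : 0 <= cabs z.
Proof. by rewrite -(lecR 0) -cabsE normr_ge0. Qed.

Lemma cabsD z w : cabs (z + w) <= cabs z + cabs w.
Proof. by rewrite -lecR rmorphD /= -!cabsE ler_normD. Qed.

Lemma cabsM z w : cabs (z * w) = cabs z * cabs w.
Proof. by apply/complexI; rewrite rmorphM /= -!cabsE normrM. Qed.

Lemma cabsN z : cabs (- z) = cabs z.
Proof. by rewrite /cabs normrN. Qed.

Lemma cabsB z w : cabs (z - w) <= cabs z + cabs w.
Proof. by rewrite -[cabs w]cabsN cabsD. Qed.

Lemma cabs0_eq0 z : cabs z = 0 -> z = 0.
Proof. by move=> z0; apply/eqP; rewrite -normr_eq0 cabsE z0. Qed.

Lemma cabs_sqr z : cabs z ^+ 2 = complex.Re z ^+ 2 + complex.Im z ^+ 2.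
Proof. by apply/complexI; rewrite rmorphXn /= -cabsE -add_Re2_Im2. Qed.

Lemma cabs_conj z : cabs z^* = cabs z.
Proof. by rewrite /cabs norm_conjC. Qed.

Lemma Re_le_cabs z : `|complex.Re z| <= cabs z.
Proof.
rewrite -(@ler_pXn2r _ 2) ?nnegrE ?cabs_ge0 // cabs_sqr real_normK ?num_real //.
by rewrite lerDl sqr_ge0.
Qed.

Lemma Im_le_cabs z : `|complex.Im z| <= cabs z.
Proof.
rewrite -(@ler_pXn2r _ 2) ?nnegrE ?cabs_ge0 // cabs_sqr real_normK ?num_real //.
by rewrite lerDr sqr_ge0.
Qed.

Lemma cabs_le_ReIm z : cabs z <= `|complex.Re z| + `|complex.Im z|.
Proof.
rewrite -(@ler_pXn2r _ 2) ?nnegrE ?cabs_ge0 ?addr_ge0 // cabs_sqr sqrrD.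
rewrite !real_normK ?num_real // -subr_ge0.
have -> : forall a b c : R, a + b *+ 2 + c - (a + c) = b *+ 2 by move=> *; ring.
by rewrite mulrn_wge0 // mulr_ge0.
Qed.

Lemma complex_eq1 z : complex.Re z = 1 -> cabs z <= 1 -> z = 1.
Proof.
move=> z1 zn; have : cabs z ^+ 2 <= 1 by rewrite expr_le1 ?cabs_ge0.
rewrite cabs_sqr z1 expr1n gerDl => H.
have : complex.Im z ^+ 2 == 0 by rewrite eq_le H sqr_ge0.
rewrite sqrf_eq0 => /eqP z0.
by apply/eqP; rewrite eq_complex /= z1 z0 !eqxx.
Qed.

End ComplexModulus.

(** A seminorm, because the unitization of a unital [A] acts on [A] with a kernel; [opnorm 1] is
    only bounded by 1, which also covers [A = 0]. *)
HB.mixin Record isCStarSeminormed (R : realType) U & GRing.Algebra R[i] U := {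
  adj : U -> U;
  opnorm : U -> R;
  adjD : {morph adj : x y / x + y};
  adjZ : forall (k : R[i]) x, adj (k *: x) = k^* *: adj x;
  adjM : forall x y, adj (x * y) = adj y * adj x;
  adjK : involutive adj;
  opnorm_ge0 : forall x, 0 <= opnorm x;
  opnormD : forall x y, opnorm (x + y) <= opnorm x + opnorm y;
  opnormZ : forall (k : R[i]) x, opnorm (k *: x) = cabs k * opnorm x;
  opnormM : forall x y, opnorm (x * y) <= opnorm x * opnorm y;
  opnorm_adjM : forall x, opnorm (adj x * x) = opnorm x ^+ 2;
  opnorm1 : opnorm 1 <= 1
}.

#[short(type="cstarSeminormedType")]
HB.structure Definition CStarSeminormed (R : realType) :=
  {U of GRing.Algebra R[i] U & isCStarSeminormed R U}.

(** * Elementary properties of C*-seminorms *)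

Section SeminormBasics.
Variables (R : realType) (U : cstarSeminormedType R).
Implicit Types (x y m q h : U) (k : R[i]) (r s : R).

Lemma adj0 : adj (0 : U) = 0.
Proof. by apply: (addrI (adj 0)); rewrite -adjD !addr0. Qed.

Lemma adjN x : adj (- x) = - adj x.
Proof. by apply/eqP; rewrite -subr_eq0 opprK -adjD addNr adj0. Qed.

Lemma adjB x y : adj (x - y) = adj x - adj y.
Proof. by rewrite adjD adjN. Qed.

Lemma adj1 : adj (1 : U) = 1.
Proof. by rewrite -[LHS]mulr1 -{2}(adjK 1) -adjM mulr1 adjK. Qed.

Lemma adjX x n : adj (x ^+ n) = adj x ^+ n.
Proof. by elim: n => [|n IH]; rewrite ?adj1 // exprS adjM IH exprSr. Qed.

Lemma adj_real r x : adj (r%:C *: x) = r%:C *: adj x.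
Proof. by rewrite adjZ conj_real_complex. Qed.

Lemma opnormR r x : opnorm (r%:C *: x) = `|r| * opnorm x.
Proof. by rewrite opnormZ cabs_real. Qed.

Lemma opnorm_double x : opnorm (x *+ 2) = 2 * opnorm x.
Proof. by rewrite -scaler_nat -(rmorph_nat (real_complex R)) opnormR normr_nat. Qed.

Lemma opnorm0 : opnorm (0 : U) = 0.
Proof. by rewrite -(scale0r (0 : U)) opnormZ /cabs normr0 mul0r. Qed.

Lemma opnormN x : opnorm (- x) = opnorm x.
Proof. by rewrite -scaleN1r opnormZ /cabs normrN normr1 mul1r. Qed.

Lemma opnormB x y : opnorm (x - y) <= opnorm x + opnorm y.
Proof. by rewrite -[opnorm y]opnormN opnormD. Qed.

Lemma opnorm_scal r : opnorm (r%:C *: 1 : U) <= `|r|.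
Proof. by rewrite opnormR ler_piMr // opnorm1. Qed.

Lemma opnorm_adj x : opnorm (adj x) = opnorm x.
Proof.
suff le y : opnorm y <= opnorm (adj y).
  by apply/eqP; rewrite eq_le le andbT -{2}(adjK x) le.
have [->|y0] := eqVneq (opnorm y) 0; first exact: opnorm_ge0.
have yp : 0 < opnorm y by rewrite lt_neqAle eq_sym y0 opnorm_ge0.
by rewrite -(ler_pM2r yp) -expr2 -opnorm_adjM opnormM.
Qed.

Lemma opnorm_sqr h : adj h = h -> opnorm (h * h) = opnorm h ^+ 2.
Proof. by move=> hh; rewrite -opnorm_adjM hh. Qed.

Lemma opnorm_mul_le x y r s :
  opnorm x <= r -> opnorm y <= s -> opnorm (x * y) <= r * s.
Proof. by move=> xr ys; apply: le_trans (opnormM _ _) _; rewrite ler_pM ?opnorm_ge0. Qed.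

Lemma opnormX x r n : opnorm x <= r -> opnorm (x ^+ n) <= r ^+ n.
Proof.
move=> xr; elim: n => [|n IH]; first by rewrite !expr0 opnorm1.
by rewrite !exprS opnorm_mul_le.
Qed.

Lemma comm_scale k x y : GRing.comm x y -> GRing.comm x (k *: y).
Proof. by rewrite /GRing.comm => xy; rewrite -scalerAr -scalerAl xy. Qed.

End SeminormBasics.

(** * Approximate square roots *)

Section SquareRoot.
Variables (R : realType) (U : cstarSeminormedType R).
Implicit Types (x y m q h : U) (k : R[i]) (r s : R).

Lemma expr_small r e : 0 <= r < 1 -> 0 < e -> exists n, r ^+ n <= e.
Proof.
move=> /andP[r0 r1] e0.
have : (fun n => r ^+ n) @ \oo --> (0 : R) by apply: cvg_expr; rewrite ger0_norm.
move/cvgrPdist_le => /(_ e e0)[n _ /(_ n (leqnn n))].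
by rewrite sub0r normrN => H; exists n; apply: le_trans H; exact: ler_norm.
Qed.

(* 1 - q is an approximate square root of 1 - m. *)
Lemma sqrt_approx m d e : adj m = m -> opnorm m <= d -> 0 <= d < 1 -> 0 < e ->
  exists q, [/\ adj q = q, forall y, GRing.comm y m -> GRing.comm y q,
    opnorm q <= d & opnorm (m + q * q - q *+ 2) <= e].
Proof.
move=> mm md d01 e0; have /andP[d0 d1] := d01.
(* A fixed point satisfies [(1 - q)^2 = 1 - m]. At the [n]-th iterate the defect
   [m + q * q - q *+ 2] is exactly twice the next increment. *)
pose F q := ((2^-1 : R)%:C : R[i]) *: (m + q * q).
pose q n := iter n F 0.
have half2 x : (((2^-1 : R)%:C : R[i]) *: x) *+ 2 = x.
  rewrite -scaler_nat scalerA -(rmorph_nat (real_complex R)) -rmorphM /=.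
  by rewrite mulfV ?scale1r // pnatr_eq0.
have qq n : adj (q n) = q n.
  by elim: n => [|n IH] /=; rewrite ?adj0 // adj_real adjD adjM mm IH.
have qc y n : GRing.comm y m -> GRing.comm y (q n).
  move=> ym; elim: n => [|n IH]; first exact: commr0.
  by apply: comm_scale; apply: commrD => //; apply: commrM.
have qd n : opnorm (q n) <= d.
  elim: n => [|n IH] /=; first by rewrite opnorm0.
  rewrite opnormR ger0_norm ?invr_ge0 //.
  have := le_trans (opnormD m _) (lerD md (opnorm_mul_le IH IH)).
  by move: (opnorm _) => a; nra.
(* The iterates commute, so each increment is half the previous one times a sum of two iterates,
   which has norm at most [2 * d]. *)
have qS n : opnorm (q n.+1 - q n) <= d ^+ n.+1.
  elim: n => [|n IH].
    rewrite /= /F subr0 mul0r addr0 opnormR ger0_norm ?invr_ge0 //.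
    by have := opnorm_ge0 m; rewrite expr1; lra.
  have -> : q n.+2 - q n.+1 =
      ((2^-1 : R)%:C : R[i]) *: ((q n.+1 - q n) * (q n.+1 + q n)).
    rewrite -[q n.+2]/(F (q n.+1)) -[X in _ - X]/(F (q n)) /F -scalerBr.
    congr (_ *: _).
    have c : q n.+1 * q n = q n * q n.+1 by apply/qc/commr_sym/qc.
    rewrite mulrBl !mulrDr c; ncring.
  rewrite opnormR ger0_norm ?invr_ge0 //.
  have := opnorm_mul_le IH (le_trans (opnormD _ _) (lerD (qd n.+1) (qd n))).
  rewrite [d ^+ n.+2]exprSr; move: (opnorm _) => a; lra.
have [n dn] := expr_small d01 (divr_gt0 e0 (ltr0n R 2)).
exists (q n); split=> //; first by move=> y; exact: qc.
have -> : m + q n * q n - q n *+ 2 = (q n.+1 - q n) *+ 2.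
  by rewrite mulrnBl half2.
rewrite mulr2n; apply: le_trans (opnormD _ _) _.
have := qS n; have : d ^+ n.+1 <= d ^+ n by rewrite ler_wiXn2l // ltW.
lra.
Qed.

(** If [q] approximates [1 - sqrt (1 - h^2)], the nearly unitary [u] below has real part [1 - q];
    hence [1 - q] has norm nearly at most 1, and its square is nearly [1 - h * h]. *)
Lemma opnorm_1sub_sqr h : adj h = h -> opnorm h <= 1 -> opnorm (1 - h * h) <= 1.
Proof.
wlog [d d01 hd] : h / exists2 d, 0 <= d < 1 & opnorm (h * h) <= d.
  move=> IH hh h1; apply/ler_addgt0Pr => e e0.
  (* The square root iteration needs a bound strictly below 1, so [h] is shrunk by [s < 1], close
     enough to 1 that [1 - s^2 <= e]. *)
  pose s := 1 - Num.min (e / 2) (1 / 2).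
  have s01 : 0 <= s < 1.
    by rewrite /s; case: (leP (e/2) (1/2)) => ?; apply/andP; lra.
  have s2 : 1 - s ^+ 2 <= e.
    by rewrite /s expr2; case: (leP (e/2) (1/2)) => ?; nra.
  have /andP[s0 s1] := s01.
  have H : opnorm (1 - (s%:C *: h) * (s%:C *: h)) <= 1.
    apply: IH.
    - exists (s ^+ 2).
        by rewrite sqr_ge0 expr2 /=; nra.
      rewrite -scalerAl -scalerAr !opnormR ger0_norm // mulrA -expr2.
      by rewrite ler_piMr ?sqr_ge0 // (opnorm_sqr hh) expr_le1 ?opnorm_ge0.
    - by rewrite adj_real hh.
    - by rewrite opnormR ger0_norm // mulr_ile1 ?opnorm_ge0 // ltW.
  have -> : 1 - h * h = 1 - (s%:C *: h) * (s%:C *: h) - (1 - s ^+ 2)%:C *: (h * h).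
    rewrite -scalerAl -scalerAr scalerA -rmorphM -expr2 rmorphB rmorph1 /=.
    by rewrite scalerBl scale1r opprB addrA addrNK.
  apply: le_trans (opnormB _ _) _; apply: lerD => //.
  rewrite opnormR ger0_norm; last by rewrite subr_ge0 expr_le1 // ltW.
  apply: le_trans s2; rewrite ler_piMr //; first by rewrite subr_ge0 expr_le1 // ltW.
  by rewrite (opnorm_sqr hh) expr_le1 ?opnorm_ge0.
move=> hh _; apply/ler_addgt0Pr => e e0.
(* Chosen so that the final bound [(1 + f)^2 + f <= 1 + 4 f] is at most [1 + e]. *)
pose f := Num.min (e / 4) 1.
have f0 : 0 < f by rewrite /f lt_min; apply/andP; lra.
have fe : f <= e / 4 /\ f <= 1 by split; rewrite /f ge_min lexx ?orbT.
have hhs : adj (h * h) = h * h by rewrite adjM hh.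
have [q [qq qc qd qe]] := sqrt_approx hhs hd d01 f0.
have qh : q * h = h * q by apply/esym/qc; apply: commrM.
(* u is nearly unitary, since u^* u = (1 - q)^2 + h^2 is nearly 1. *)
pose u := (1 - q) + 'i *: h.
have ua : adj u = (1 - q) - 'i *: h.
  by rewrite adjD adjB adj1 qq adjZ conjCi hh scaleNr.
have uu : adj u * u = 1 + (h * h + q * q - q *+ 2).
  rewrite ua /u mulrDr !mulrBl -!scalerAr -!scalerAl scalerA -expr2.
  rewrite sqrCi scaleN1r !mulrBr !mul1r !mulr1 qh scalerBr.
  ncring.
have u1 : opnorm u <= 1 + f.
  rewrite -(@ler_pXn2r _ 2) ?nnegrE ?opnorm_ge0 //; last lra.
  rewrite -opnorm_adjM uu; apply: le_trans (opnormD _ _) _.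
  have := @opnorm1 _ U; rewrite expr2; nra.
have q1 : opnorm (1 - q) <= 1 + f.
  have : opnorm ((1 - q) *+ 2) <= (1 + f) * 2.
    have -> : (1 - q) *+ 2 = u + adj u by rewrite ua /u; ncring.
    apply: le_trans (opnormD _ _) _; rewrite opnorm_adj; lra.
  by rewrite opnorm_double; lra.
have -> : 1 - h * h = (1 - q) * (1 - q) - (h * h + q * q - q *+ 2) by ncring.
apply: le_trans (opnormB _ _) _.
have := opnorm_mul_le q1 q1; nra.
Qed.

End SquareRoot.

(** * The cone of positive elements *)

Section PositiveCone.
Variables (R : realType) (U : cstarSeminormedType R).
Implicit Types (x y a b h k q : U) (r s e : R).

Local Notation "r %:U" := (r%:C *: (1 : U)) (at level 2).

(* Equivalent to having a nonnegative spectrum, and a convex cone at sight. *)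
Definition pos x := adj x = x /\ exists2 r, 0 <= r & opnorm (r%:U - x) <= r.

Lemma scalD r s : (r + s)%:U = r%:U + s%:U.
Proof. by rewrite rmorphD scalerDl. Qed.

Lemma scalB r s : (r - s)%:U = r%:U - s%:U.
Proof. by rewrite rmorphB scalerBl. Qed.

Lemma adj_scal r : adj r%:U = r%:U.
Proof. by rewrite adj_real adj1. Qed.

Lemma opnorm_sub_mono x r s :
  opnorm (r%:U - x) <= r -> r <= s -> opnorm (s%:U - x) <= s.
Proof.
move=> xr rs; have -> : s%:U - x = (s - r)%:U + (r%:U - x).
  by rewrite scalB addrA subrK.
apply: le_trans (opnormD _ _) _; have := opnorm_scal U (s - r).
by rewrite ger0_norm ?subr_ge0 //; lra.
Qed.

Lemma posD x y : pos x -> pos y -> pos (x + y).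
Proof.
move=> [xx [r r0 xr]] [yy [s s0 ys]]; split; first by rewrite adjD xx yy.
exists (r + s); first exact: addr_ge0.
rewrite scalD opprD addrACA; apply: le_trans (opnormD _ _) _; exact: lerD.
Qed.

Lemma posZ r x : 0 <= r -> pos x -> pos (r%:C *: x).
Proof.
move=> r0 [xx [s s0 xs]]; split; first by rewrite adj_real xx.
exists (r * s); first exact: mulr_ge0.
by rewrite rmorphM -scalerA -scalerBr opnormR ger0_norm // ler_wpM2l.
Qed.

Lemma pos_scal_sub x r : adj x = x -> opnorm x <= r -> pos (r%:U - x).
Proof.
move=> xx xr; split; first by rewrite adjB adj_scal xx.
exists r; last by rewrite opprB addrCA subrr addr0.
exact: le_trans (opnorm_ge0 x) xr.
Qed.

Lemma pos0 : pos 0.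
Proof. by split; [exact: adj0|exists 0; rewrite // scale0r subr0 opnorm0]. Qed.

Lemma pos_scal r : 0 <= r -> pos r%:U.
Proof. by move=> r0; rewrite -[_%:U]subr0; apply: pos_scal_sub; rewrite ?adj0 ?opnorm0. Qed.

Lemma pos1 : pos 1.
Proof. by have := @pos_scal 1 ler01; rewrite rmorph1 scale1r. Qed.

(** Write [x = l (1 - m')] with [m'] in the unit ball, shrink [m'] slightly and apply [sqrt_approx].
    The clause on commutation gives commuting roots to commuting elements. *)
Lemma pos_sqrt_approx x e : pos x -> 0 < e ->
  exists h, [/\ adj h = h, forall y, GRing.comm y x -> GRing.comm y h
    & opnorm (x - h * h) <= e].
Proof.
move=> [xx [r r0 xr]] e0.
pose l := r + 1; have l0 : 0 < l by rewrite ltr_wpDl.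
have xl : opnorm (l%:U - x) <= l by apply: opnorm_sub_mono xr _; rewrite lerDl.
pose m' := (l^-1)%:C *: (l%:U - x).
have m'1 : opnorm m' <= 1.
  by rewrite opnormR gtr0_norm ?invr_gt0 // mulrC ler_pdivrMr ?mul1r.
have xm : x = l%:C *: (1 - m').
  rewrite scalerBr scalerA -rmorphM mulfV ?gt_eqF // rmorph1 scale1r.
  by rewrite opprB addrCA subrr addr0.
(* Shrinking [m'] and stopping the iteration each cost at most [d], both multiplied by [l]. *)
pose d := Num.min (e / (2 * l)) (1 / 2).
have d0 : 0 < d.
  by rewrite /d lt_min divr_gt0 ?mulr_gt0 //=; lra.
have d1 : d <= 1 / 2 by rewrite /d ge_min lexx orbT.
have ld : 2 * l * d <= e.
  by rewrite mulrC -ler_pdivlMr ?mulr_gt0 // /d ge_min lexx.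
pose m := (1 - d)%:C *: m'.
have mm : adj m = m by rewrite !adj_real adjB adj_scal xx.
have m1 : opnorm m <= 1 - d by rewrite opnormR ger0_norm ?ler_piMr //; lra.
have d01 : 0 <= 1 - d < 1 by apply/andP; lra.
have [q [qq qc _ qe]] := sqrt_approx mm m1 d01 d0.
exists ((Num.sqrt l)%:C *: (1 - q)); split.
- by rewrite adj_real adjB adj1 qq.
- move=> y yx; apply/comm_scale/commrB; first exact: commr1.
  apply/qc/comm_scale/comm_scale/commrB => //.
  by apply/comm_scale/commr1.
- rewrite -scalerAl -scalerAr scalerA -rmorphM -expr2 sqr_sqrtr; last exact: ltW.
  rewrite xm -scalerBr opnormR gtr0_norm //.
  have -> : 1 - m' - (1 - q) * (1 - q) = - (m + q * q - q *+ 2) - d%:C *: m'.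
    rewrite /m rmorphB rmorph1 scalerBl scale1r; move: (d%:C *: m') => z; ncring.
  have : opnorm (- (m + q * q - q *+ 2) - d%:C *: m') <= 2 * d.
    apply: le_trans (opnormB _ _) _.
    rewrite opnormN opnormR gtr0_norm // mulr_natl mulr2n; apply: lerD => //.
    by rewrite ler_piMr // ltW.
  move=> H; apply: le_trans ld.
  have -> : 2 * l * d = l * (2 * d) by ring.
  by apply: ler_wpM2l => //; exact: ltW.
Qed.

Lemma opnorm_sub_sqr h r : adj h = h -> opnorm (h * h) <= r ->
  opnorm (r%:U - h * h) <= r.
Proof.
move=> hh; have [->|r0] := eqVneq r 0; first by rewrite scale0r sub0r opnormN.
move=> hr; have {r0} r0 : 0 < r.
  by rewrite lt_neqAle eq_sym r0 (le_trans (opnorm_ge0 _) hr).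
have s0 : 0 < Num.sqrt r by rewrite sqrtr_gt0.
pose g := ((Num.sqrt r)^-1)%:C *: h.
have gE : h = (Num.sqrt r)%:C *: g.
  by rewrite scalerA -rmorphM mulfV ?gt_eqF // rmorph1 scale1r.
have gg : adj g = g by rewrite adj_real hh.
have hgE : h * h = r%:C *: (g * g).
  by rewrite gE -scalerAl -scalerAr scalerA -rmorphM -expr2 sqr_sqrtr // ltW.
have g1 : opnorm g <= 1.
  rewrite -(@expr_le1 _ 2) ?opnorm_ge0 // -(opnorm_sqr gg).
  by move: hr; rewrite hgE opnormR gtr0_norm // ger_pMr.
rewrite hgE -scalerBr opnormR gtr0_norm // ger_pMr //.
exact: opnorm_1sub_sqr.
Qed.

Lemma pos_sqr h : adj h = h -> pos (h * h).
Proof.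
move=> hh; split; first by rewrite adjM hh.
by exists (opnorm (h * h)); rewrite ?opnorm_ge0 //; exact: opnorm_sub_sqr.
Qed.

(** Replacing [x] by a nearby square reduces this to [opnorm_sub_sqr]. It frees positivity from its
    existential radius: every bound of the norm will do. *)
Lemma pos_opnorm_sub x r : pos x -> opnorm x <= r -> opnorm (r%:U - x) <= r.
Proof.
move=> px xr; apply/ler_addgt0Pr => e e0.
have e3 : 0 < e / 3 by lra.
have [h [hh _ xh]] := pos_sqrt_approx px e3.
have H : opnorm ((r + e / 3)%:U - h * h) <= r + e / 3.
  apply: opnorm_sub_sqr => //; have -> : h * h = x - (x - h * h) by ncring.
  by apply: le_trans (opnormB _ _) _; apply: lerD.
have -> : r%:U - x = (r + e / 3)%:U - h * h - (x - h * h) - (e / 3)%:U.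
  by rewrite scalD; ncring.
apply: le_trans (opnormB _ _) _; have := opnorm_scal U (e / 3).
have := opnormB ((r + e / 3)%:U - h * h) (x - h * h).
rewrite (gtr0_norm e3); lra.
Qed.

(** By [pos_opnorm_sub] all close approximants share the radius [opnorm x + 1], so the inequality
    passes to the limit. *)
Lemma pos_closed x : adj x = x ->
  (forall e, 0 < e -> exists2 y, pos y & opnorm (x - y) <= e) -> pos x.
Proof.
move=> xx H; split=> //; exists (opnorm x + 1).
  by rewrite addr_ge0 ?opnorm_ge0.
apply/ler_addgt0Pr => e e0.
have d0 : 0 < Num.min e 1 by rewrite lt_min e0 ltr01.
have [y py xy] := H _ d0.
have [de d1] : Num.min e 1 <= e /\ Num.min e 1 <= 1.
  by split; rewrite ge_min lexx ?orbT.
have yx : opnorm y <= opnorm x + 1.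
  have -> : y = x - (x - y) by ncring.
  by apply: le_trans (opnormB _ _) _; apply: lerD => //; exact: le_trans d1.
have -> : (opnorm x + 1)%:U - x = (opnorm x + 1)%:U - y - (x - y) by ncring.
apply: le_trans (opnormB _ _) _; apply: lerD; first exact: pos_opnorm_sub.
exact: le_trans de.
Qed.

(** With commuting [h * h] near [a] and [k * k] near [r - a], the element [u = h + i k] has
    [adj u * u] near [r]; its real part [h] is no larger in norm than [u]. *)
Lemma opnorm_le_pos a r : 0 <= r -> pos a -> pos (r%:U - a) -> opnorm a <= r.
Proof.
move=> r0 pa pb; apply/ler_addgt0Pr => e e0.
have e3 : 0 < e / 3 by lra.
have [h [hh hc ah]] := pos_sqrt_approx pa e3.
have [k [kk kc ak]] := pos_sqrt_approx pb e3.
have kh : k * h = h * k.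
  apply/hc/commr_sym/kc/commrB; last exact: commr_refl.
  by apply/comm_scale/commr1.
pose u := h + 'i *: k.
have ua : adj u = h - 'i *: k by rewrite adjD hh adjZ conjCi kk scaleNr.
have uu : adj u * u = r%:U - (a - h * h) - (r%:U - a - k * k).
  rewrite ua /u mulrDr !mulrBl -!scalerAr -!scalerAl scalerA -['i * 'i]expr2.
  rewrite sqrCi scaleN1r kh; ncring.
have u2 : opnorm u ^+ 2 <= r + e / 3 + e / 3.
  rewrite -opnorm_adjM uu; apply: le_trans (opnormB _ _) _; apply: lerD => //.
  apply: le_trans (opnormB _ _) _; apply: lerD => //.
  by apply: le_trans (opnorm_scal _ _) _; rewrite ger0_norm.
have hu : opnorm h <= opnorm u.
  have : opnorm (h *+ 2) <= opnorm u + opnorm (adj u).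
    have -> : h *+ 2 = u + adj u by rewrite ua /u; ncring.
    exact: opnormD.
  by rewrite opnorm_double opnorm_adj; lra.
have h2 : opnorm h ^+ 2 <= opnorm u ^+ 2.
  by rewrite ler_pXn2r // nnegrE opnorm_ge0.
have -> : a = (a - h * h) + h * h by ncring.
apply: le_trans (opnormD _ _) _; rewrite (opnorm_sqr hh); lra.
Qed.

(** Commuting approximate roots [h] and [k] make [a * b] close to the square of the self-adjoint
    [h * k]. *)
Lemma pos_mul a b : pos a -> pos b -> GRing.comm a b -> pos (a * b).
Proof.
move=> pa pb ab; apply: pos_closed => [|e e0].
  by rewrite adjM (proj1 pa) (proj1 pb) ab.
have a0 := opnorm_ge0 a; have b0 := opnorm_ge0 b.
(* The error is at most [d * opnorm b + (opnorm a + d) * d], hence at most [d * c] as [d <= 1]. *)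
pose c := opnorm a + opnorm b + 1; have c0 : 0 < c by rewrite /c; lra.
pose d := Num.min (e / c) 1.
have d0 : 0 < d by rewrite /d lt_min divr_gt0 //=.
have [d1 dc] : d <= 1 /\ d * c <= e.
  by rewrite -ler_pdivlMr // /d; split; rewrite ge_min lexx ?orbT.
have [h [hh hc ah]] := pos_sqrt_approx pa d0.
have [k [kk kc bk]] := pos_sqrt_approx pb d0.
have kh : k * h = h * k by apply/hc/commr_sym/kc.
exists ((h * k) * (h * k)); first by apply: pos_sqr; rewrite adjM hh kk.
have -> : a * b - h * k * (h * k) = (a - h * h) * b + h * h * (b - k * k).
  have -> : h * k * (h * k) = h * h * (k * k) by rewrite -!mulrA (mulrA k) kh !mulrA.
  ncring.
have hN : opnorm (h * h) <= opnorm a + d.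
  have -> : h * h = a - (a - h * h) by ncring.
  by apply: le_trans (opnormB _ _) _; exact: lerD.
apply: le_trans (opnormD _ _) _.
have := opnorm_mul_le ah (lexx (opnorm b)); have := opnorm_mul_le hN bk.
by move: dc; rewrite /c; nra.
Qed.

Lemma posX a n : pos a -> pos (a ^+ n).
Proof.
move=> pa; elim: n => [|n IH]; first exact: pos1.
by rewrite exprS; apply: pos_mul => //; exact/commrX/commr_refl.
Qed.

Lemma pos_sum n (F : 'I_n -> U) : (forall i, pos (F i)) -> pos (\sum_i F i).
Proof. by move=> pF; elim/big_ind: _ => //; [exact: pos0|exact: posD]. Qed.

End PositiveCone.

(** * Positivity of [adj y * y], and norm estimates drawn from the order *)

Section KelleyVaught.
Variables (R : realType) (U : cstarSeminormedType R).
Implicit Types (x y v w a b e f : U) (r s t : R).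

Local Notation "r %:U" := (r%:C *: (1 : U)) (at level 2).

Lemma bernoulli t n : 0 <= t -> 1 + n%:R * t <= (1 + t) ^+ n.
Proof.
move=> t0; elim: n => [|n IH]; first by rewrite mul0r addr0.
rewrite exprS -natr1; have : 0 <= n%:R * t * t by rewrite !mulr_ge0.
nra.
Qed.

(** For self-adjoint [v] the powers with exponent [2 ^ k] have norm exactly [opnorm v ^+ (2 ^ k)],
    so a ratio above [r] would grow geometrically and beat the linear factor. *)
Lemma opnorm_le_growth v r s t : adj v = v -> 0 < r -> 0 <= s -> 0 <= t ->
  (forall n, opnorm (v ^+ n) <= (s + t * n%:R) * r ^+ n) -> opnorm v <= r.
Proof.
move=> vv r0 s0 t0 H; rewrite leNgt; apply/negP => rv.
have pow k : opnorm (v ^+ (2 ^ k)) = opnorm v ^+ (2 ^ k).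
  elim: k => [|k IH]; first by rewrite !expr1.
  by rewrite expnSr !exprM -IH expr2 opnorm_sqr // adjX vv.
(* Here [opnorm v / r = (1 + d)^2]: the square lets Bernoulli's inequality give the quadratic lower
   bound [(n * d)^2]. *)
pose d := Num.sqrt (opnorm v / r) - 1.
have d0 : 0 < d.
  rewrite subr_gt0 -[X in X < _]sqrtr1 ltr_sqrt; first by rewrite ltr_pdivlMr ?mul1r.
  by rewrite divr_gt0 // (lt_trans r0 rv).
have vE : opnorm v = (1 + d) ^+ 2 * r.
  rewrite /d addrC subrK sqr_sqrtr ?divfK ?gt_eqF //.
  by rewrite divr_ge0 ?opnorm_ge0 // ltW.
have st0 : 0 <= (s + t) / d ^+ 2 by rewrite divr_ge0 ?sqr_ge0 ?addr_ge0.
have := archi_boundP st0; set k := Num.bound _ => kb.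
pose n := (2 ^ k)%N.
have kn : (k < n)%N by rewrite ltn_expl.
have n0 : 0 < n%:R :> R by rewrite ltr0n (leq_ltn_trans _ kn).
have := H n; rewrite pow vE exprMn ler_pM2r ?exprn_gt0 // -exprM mulnC exprM.
have d1 : n%:R * d <= (1 + d) ^+ n.
  by apply: le_trans (bernoulli _ (ltW d0)); rewrite lerDr.
have d2 : (n%:R * d) ^+ 2 <= ((1 + d) ^+ n) ^+ 2.
  have d0' : 0 <= 1 + d by lra.
  by rewrite ler_pXn2r ?nnegrE ?exprn_ge0 ?mulr_ge0 // ltW.
move=> /(le_trans d2); rewrite leNgt => /negP; apply.
have n1 : 1 <= n%:R :> R by rewrite ler1n (leq_ltn_trans _ kn).
have : s + t < n%:R * d ^+ 2.
  rewrite -ltr_pdivrMr ?exprn_gt0 //; apply: lt_trans kb _.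
  by rewrite ltr_nat.
rewrite -(ltr_pM2l n0) exprMn expr2 -mulrA; apply: le_lt_trans.
nra.
Qed.

(* Uses (K + w w^* )^n w = w (K + w^* w)^n: the powers of K + w w^* grow at most
   like n L^n as soon as |K + w^* w| <= L. *)
Lemma pos_1sub_adjC w : pos (1 - adj w * w) -> pos (1 - w * adj w).
Proof.
move=> pw; pose K := opnorm w ^+ 2; pose L := K + 1.
have K0 : 0 <= K by rewrite sqr_ge0.
have L1 : 1 <= L by rewrite lerDr.
have L0 : 0 < L by apply: lt_le_trans L1.
pose r := K%:U + adj w * w; pose g := K%:U + w * adj w.
have rL : opnorm r <= L.
  have -> : r = L%:U - (1 - adj w * w).
    by rewrite scalD rmorph1 scale1r /r; ncring.
  apply: pos_opnorm_sub => //; apply: le_trans (opnormB _ _) _.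
  by rewrite opnorm_adjM addrC lerD2l opnorm1.
have gw n : g ^+ n * w = w * r ^+ n.
  elim: n => [|n IH]; first by rewrite !expr0 mul1r mulr1.
  rewrite exprSr -mulrA (_ : g * w = w * r) ?mulrA ?IH -?mulrA -?exprSr //.
  by rewrite /g /r mulrDl mulrDr -scalerAl -scalerAr mul1r mulr1 mulrA.
have gn n : opnorm (g ^+ n) <= (1 + K * n%:R) * L ^+ n.
  elim: n => [|n IH]; first by rewrite !expr0 mulr0 addr0 mulr1 opnorm1.
  have -> : g ^+ n.+1 = K%:C *: g ^+ n + w * r ^+ n * adj w.
    by rewrite exprSr {2}/g mulrDr mulrA gw -scalerAr mulr1.
  apply: le_trans (opnormD _ _) _; rewrite opnormR ger0_norm //.
  have wr : opnorm (w * r ^+ n * adj w) <= K * L ^+ n.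
    have := opnorm_mul_le (opnorm_mul_le (lexx (opnorm w)) (opnormX n rL))
      (lexx (opnorm (adj w))).
    by rewrite opnorm_adj /K expr2 mulrAC.
  have LX : 0 <= L ^+ n by rewrite exprn_ge0 // ltW.
  have : K * opnorm (g ^+ n) <= K * ((1 + K * n%:R) * L ^+ n) by rewrite ler_wpM2l.
  rewrite -natr1 exprS; move: (L ^+ n) wr LX => X wr X0.
  have : 0 <= K * n%:R * X by apply: mulr_ge0 => //; apply: mulr_ge0.
  have : 0 <= K * K * X by apply: mulr_ge0 => //; apply: mulr_ge0.
  by rewrite /L; lra.
(* As [g = L%:U - (1 - w * adj w)], this bound is the desired positivity with radius [L]. *)
have gL : opnorm g <= L.
  by apply: opnorm_le_growth (ler01) K0 gn; rewrite // adjD adj_scal adjM adjK.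
split; first by rewrite adjB adj1 adjM adjK.
exists L; first exact: ltW.
have -> : L%:U - (1 - w * adj w) = g by rewrite scalD rmorph1 scale1r /g; ncring.
by [].
Qed.

(** The element is twice the sum of the squares of the real and imaginary parts of [w]. *)
Lemma pos_adj_mulD w : pos (adj w * w + w * adj w).
Proof.
have -> : adj w * w + w * adj w = (2^-1)%:C *: ((w + adj w) * (w + adj w) +
    ('i *: (w - adj w)) * ('i *: (w - adj w))).
  rewrite -scalerAl -scalerAr scalerA -['i * 'i]expr2 sqrCi scaleN1r.
  have -> : (w + adj w) * (w + adj w) - (w - adj w) * (w - adj w) =
      (adj w * w + w * adj w) *+ 2 by ncring.
  rewrite -[X in _ = _ *: X]scaler_nat scalerA -(rmorph_nat (real_complex R)) -rmorphM /=.
  by rewrite mulVf ?rmorph1 ?scale1r // pnatr_eq0.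
apply: posZ; first by rewrite invr_ge0.
apply: posD; apply: pos_sqr; first by rewrite adjD adjK addrC.
by rewrite adjZ conjCi adjB adjK scaleNr -scalerN opprB.
Qed.

(* For x = y^* y, v = 1 - x and w = y v^m, both 1 - w w^* and w w^* + w^* w are
   positive, which bounds w^* w = v^(2m) - v^(2m+1) uniformly in m.  So |v^n|
   grows linearly at most, and |v| <= 1. *)
Lemma pos_adj_mul y : pos (adj y * y).
Proof.
wlog y1 : y / opnorm y <= 1.
  move=> IH; pose s := opnorm y + 1.
  have s0 : 0 < s by rewrite ltr_wpDl // opnorm_ge0.
  have -> : adj y * y = (s * s)%:C *: (adj ((s^-1)%:C *: y) * ((s^-1)%:C *: y)).
    rewrite adj_real -scalerAl -scalerAr !scalerA -!rmorphM.
    have -> : s * s / s / s = 1 by field; rewrite gt_eqF.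
    by rewrite rmorph1 scale1r.
  apply: posZ; first by rewrite mulr_ge0 // ltW.
  apply: IH; rewrite opnormR gtr0_norm ?invr_gt0 // mulrC ler_pdivrMr // mul1r.
  by rewrite lerDl.
pose x := adj y * y; pose v := 1 - x.
have xx : adj x = x by rewrite adjM adjK.
have x1 : opnorm x <= 1 by rewrite opnorm_adjM expr_le1 ?opnorm_ge0.
have vv : adj v = v by rewrite adjB adj1 xx.
have v2 : opnorm v <= 2.
  by apply: le_trans (opnormB _ _) _; have := @opnorm1 _ U; lra.
have pv : pos v.
  by have := pos_scal_sub xx x1; rewrite rmorph1 scale1r.
have even m : opnorm (v ^+ (m + m) * (1 - v)) <= 3.
  pose w := y * v ^+ m.
  have wwE : adj w * w = v ^+ (m + m) * (1 - v).
    have xv : x = 1 - v by rewrite /v; ncring.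
    rewrite /w adjM adjX vv -mulrA (mulrA (adj y)) -/x xv mulrA exprD.
    rewrite -!mulrA; congr (_ * _); rewrite mulrBl mulrBr mul1r mulr1.
    by rewrite -exprS exprSr.
  have p1 : pos (1 - adj w * w).
    (* Summing the geometric series leaves [v] plus a product of two commuting positive elements. *)
    have -> : 1 - adj w * w =
        v + ((v - 1) * (v - 1)) * \sum_(i < m + m) v ^+ i.
      rewrite -mulrA -subrX1 wwE.
      have : v ^+ (m + m) * v = v * v ^+ (m + m) by rewrite -exprS exprSr.
      move: (v ^+ (m + m)) => z zv; rewrite mulrBr zv; ncring.
    apply: posD => //; apply: pos_mul.
    - by apply: pos_sqr; rewrite adjB adj1 vv.
    - by apply: pos_sum => i; exact: posX.
    - apply: commr_sum => i _; apply/commr_sym.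
      have c : GRing.comm (v ^+ i) (v - 1).
        by apply: commrB; [exact/commr_sym/commrX/commr_refl|exact: commr1].
      exact: commrM.
  have p2 : pos (1 + adj w * w).
    have -> : 1 + adj w * w = (1 - w * adj w) + (adj w * w + w * adj w) by ncring.
    by apply: posD; [exact: pos_1sub_adjC|exact: pos_adj_mulD].
  have n2 : opnorm (1 + adj w * w) <= 2.
    apply: opnorm_le_pos => //.
    have -> : (2 : R)%:U - (1 + adj w * w) = 1 - adj w * w.
      by rewrite (rmorph_nat (real_complex R)) scaler_nat; ncring.
    by [].
  rewrite -wwE; have -> : adj w * w = (1 + adj w * w) - 1 by ncring.
  by apply: le_trans (opnormB _ _) _; have := @opnorm1 _ U; lra.
(* An odd exponent costs one more factor [v], of norm at most 2. *)
have all n : opnorm (v ^+ n * (1 - v)) <= 6.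
  rewrite -(odd_double_half n) -addnn; case: (odd n); last first.
    by rewrite add0n; apply: le_trans (even _) _; lra.
  rewrite add1n exprS -mulrA.
  by apply: le_trans (opnorm_mul_le v2 (even _)) _; lra.
have grow n : opnorm (v ^+ n) <= (1 + 6 * n%:R) * 1 ^+ n.
  rewrite expr1n mulr1; elim: n => [|n IH].
    by rewrite expr0 mulr0 addr0 opnorm1.
  have -> : v ^+ n.+1 = v ^+ n - v ^+ n * (1 - v) by rewrite exprSr; ncring.
  by apply: le_trans (opnormB _ _) _; have := all n; rewrite -natr1; lra.
split=> //; exists 1 => //; rewrite rmorph1 scale1r.
by apply: opnorm_le_growth (grow) => //.
Qed.

(** For [h * h] close to [a], the element [f * a * f] is close to [adj (h * f) * (h * f)]. *)
Lemma pos_conj a f : pos a -> adj f = f -> pos (f * a * f).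
Proof.
move=> pa ff; apply: pos_closed => [|d d0].
  by rewrite !adjM ff (proj1 pa) mulrA.
have f0 := sqr_ge0 (opnorm f).
have d1 : 0 < d / (opnorm f ^+ 2 + 1) by rewrite divr_gt0 // ltr_wpDl.
have [h [hh _ ah]] := pos_sqrt_approx pa d1.
exists (adj (h * f) * (h * f)); first exact: pos_adj_mul.
have -> : f * a * f - adj (h * f) * (h * f) = f * (a - h * h) * f.
  by rewrite adjM hh ff; ncring.
apply: le_trans (opnorm_mul_le (opnorm_mul_le (lexx _) ah) (lexx _)) _.
rewrite mulrAC -expr2 mulrA ler_pdivrMr ?ltr_wpDl //.
nra.
Qed.

Lemma opnorm_1sub_le1 a : pos a -> opnorm a <= 1 ->
  pos (1 - a) /\ opnorm (1 - a) <= 1.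
Proof.
move=> pa a1; split.
  by have := pos_scal_sub (proj1 pa) a1; rewrite rmorph1 scale1r.
by have := pos_opnorm_sub pa a1; rewrite rmorph1 scale1r.
Qed.

(** The element equals [1 - (1 - a) * (1 - b)], where the product is a positive contraction. *)
Lemma opnorm_join_le1 a b : pos a -> pos b -> GRing.comm a b ->
  opnorm a <= 1 -> opnorm b <= 1 -> opnorm (a + b - a * b) <= 1.
Proof.
move=> pa pb ab a1 b1.
have [pa' a1'] := opnorm_1sub_le1 pa a1; have [pb' b1'] := opnorm_1sub_le1 pb b1.
have -> : a + b - a * b = 1 - (1 - a) * (1 - b) by ncring.
apply: (proj2 (opnorm_1sub_le1 _ _)).
  apply: pos_mul => //; apply: commrB; first exact: commr1.
  by apply/commr_sym/commrB; [exact: commr1|exact: commr_sym].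
by have := opnorm_mul_le a1' b1'; rewrite mulr1.
Qed.

(** In the order, [f (1 - a)^2 f <= f (1 - a) f <= f ((1 - a) + (1 - b)) f], and the last term is
    [2 f (1 - c) f] for the mean [c]. So an [f] nearly absorbed by the mean is nearly absorbed by
    [a]. *)
Lemma opnorm_mean_sub a b f : pos a -> pos b -> opnorm a <= 1 -> opnorm b <= 1 ->
  adj f = f -> opnorm f <= 1 ->
  opnorm (f - a * f) ^+ 2 <= 2 * opnorm (f - ((2^-1)%:C *: (a + b)) * f).
Proof.
move=> pa pb a1 b1 ff f1.
have [pa' _] := opnorm_1sub_le1 pa a1; have [pb' _] := opnorm_1sub_le1 pb b1.
set c := _ *: _; rewrite -opnorm_adjM.
have cE : c *+ 2 = a + b.
  rewrite /c -scaler_nat scalerA -(rmorph_nat (real_complex R)) -rmorphM /=.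
  by rewrite mulfV ?scale1r // pnatr_eq0.
have dE : f * ((1 - a) + (1 - b)) * f = (f * (f - c * f)) *+ 2.
  have -> : (1 - a) + (1 - b) = 1 *+ 2 - c *+ 2 by rewrite cE; ncring.
  ncring.
have pd : pos (f * ((1 - a) + (1 - b)) * f) by apply: pos_conj => //; exact: posD.
have dN : opnorm (f * ((1 - a) + (1 - b)) * f) <= 2 * opnorm (f - c * f).
  rewrite dE opnorm_double ler_wpM2l //.
  by apply: le_trans (opnorm_mul_le f1 (lexx _)) _; rewrite mul1r.
apply: opnorm_le_pos; [by rewrite mulr_ge0 ?opnorm_ge0|exact: pos_adj_mul|].
have := posD (pos_scal_sub (proj1 pd) dN) (_ : pos (f * (a * (1 - a) + (1 - b)) * f)).
have -> : forall z, z - f * ((1 - a) + (1 - b)) * f + f * (a * (1 - a) + (1 - b)) * f =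
    z - adj (f - a * f) * (f - a * f).
  by move=> z; rewrite adjB adjM ff (proj1 pa); ncring.
apply; apply: pos_conj => //; apply: posD => //; apply: pos_mul => //.
by apply: commrB; [exact: commr1|exact: commr_refl].
Qed.

(** The difference telescopes to a multiple of [a * (1 - a ^+ n.+1)]. Exponents start at 1 so that
    the means of an element of [A] stay in [A]. *)
Lemma opnorm_cesaro a n : opnorm a <= 1 ->
  opnorm ((n.+1%:R^-1)%:C *: \sum_(i < n.+1) a ^+ i.+1) <= 1 /\
  opnorm ((n.+1%:R^-1)%:C *: \sum_(i < n.+1) a ^+ i.+1 -
    a * ((n.+1%:R^-1)%:C *: \sum_(i < n.+1) a ^+ i.+1)) <= 2 / n.+1%:R.
Proof.
move=> a1; have n0 : 0 < n.+1%:R^-1 :> R by rewrite invr_gt0.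
have an k : opnorm (a ^+ k) <= 1 by have := opnormX k a1; rewrite expr1n.
have sE : \sum_(i < n.+1) a ^+ i.+1 = a * \sum_(i < n.+1) a ^+ i.
  by rewrite mulr_sumr; apply: eq_bigr => i _; rewrite exprS.
split.
  rewrite opnormR gtr0_norm // mulrC ler_pdivrMr // mul1r.
  apply: (@le_trans _ _ (\sum_(i < n.+1) 1)); last by rewrite sumr_const card_ord.
  elim/big_rec2: _ => [|i x y _ H]; first by rewrite opnorm0.
  by apply: le_trans (opnormD _ _) _; exact: lerD.
rewrite -scalerAr -scalerBr opnormR gtr0_norm // mulrC ler_pM2r //.
have -> : \sum_(i < n.+1) a ^+ i.+1 - a * \sum_(i < n.+1) a ^+ i.+1 =
    a * - ((a - 1) * \sum_(i < n.+1) a ^+ i) by rewrite sE; ncring.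
rewrite -subrX1; apply: le_trans (opnorm_mul_le a1 (lexx _)) _; rewrite mul1r opnormN.
by apply: le_trans (opnormB _ _) _; have := an n.+1; have := @opnorm1 _ U; lra.
Qed.

End KelleyVaught.

(** * Real-valued norm on [A] *)

Section RealNorm.
Variables (R : realType) (A : cstarAlgType R).
Implicit Types (a b z : A) (k : R[i]).

Definition nrm a : R := complex.Re `|a|.

Lemma nrmE a : `|a| = (nrm a)%:C.
Proof. by rewrite /nrm RRe_real // ger0_real. Qed.

Lemma nrm_ge0 a : 0 <= nrm a.
Proof. by rewrite -(lecR 0) -nrmE normr_ge0. Qed.

Lemma nrmD a b : nrm (a + b) <= nrm a + nrm b.
Proof. by rewrite -lecR rmorphD /= -!nrmE ler_normD. Qed.

Lemma nrmZ k a : nrm (k *: a) = cabs k * nrm a.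
Proof. by apply/complexI; rewrite rmorphM /= -!nrmE -cabsE normrZ. Qed.

Lemma nrmM a b : nrm (a ** b) <= nrm a * nrm b.
Proof. by rewrite -lecR rmorphM /= -!nrmE norm_cmul_le. Qed.

Lemma nrm_star_mul a : nrm (star a ** a) = nrm a ^+ 2.
Proof. by apply/complexI; rewrite rmorphXn /= -!nrmE norm_star_cmul. Qed.

Lemma nrm0_eq0 a : nrm a = 0 -> a = 0.
Proof. by move=> a0; apply/normr0_eq0; rewrite nrmE a0. Qed.

Lemma nrm0 : nrm (0 : A) = 0.
Proof. by rewrite /nrm normr0. Qed.

Lemma nrm_star a : nrm (star a) = nrm a.
Proof.
suff le b : nrm b <= nrm (star b).
  by apply/eqP; rewrite eq_le le andbT -{2}(starK a) le.
have [->|b0] := eqVneq (nrm b) 0; first exact: nrm_ge0.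
have bp : 0 < nrm b by rewrite lt_neqAle eq_sym b0 nrm_ge0.
by rewrite -(ler_pM2r bp) -expr2 -nrm_star_mul nrmM.
Qed.

Lemma cmul0l a : 0 ** a = 0.
Proof. by apply: (addrI (0 ** a)); rewrite -cmulDl !addr0. Qed.

Lemma cmul0r a : a ** 0 = 0.
Proof. by apply: (addrI (a ** 0)); rewrite -cmulDr !addr0. Qed.

End RealNorm.

(** * The unitization and its operator seminorm *)

Section Unitization.
Variables (R : realType) (A : cstarAlgType R).

Definition unitization : Type := (R[i]^o * A)%type.

HB.instance Definition _ := GRing.Lmodule.copy unitization (R[i]^o * A)%type.

Implicit Types (m n p : unitization) (a b z w : A) (k l : R[i]).

Definition umul m n : unitization :=
  ((m.1 : R[i]) * n.1, (m.1 : R[i]) *: n.2 + (n.1 : R[i]) *: m.2 + m.2 ** n.2).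
Definition uone : unitization := (1, 0).

Fact umulA : associative umul.
Proof.
move=> [k a] [l b] [j c]; rewrite /umul /=; congr (_, _); first exact: mulrA.
rewrite !scalerDr !cmulDl !cmulDr !cmulZl !cmulZr !scalerA cmulA.
rewrite (mulrC j k) (mulrC j l) -!addrA; congr (_ + _).
congr (_ + _).
rewrite addrCA; congr (_ + _).
by rewrite [X in _ + X = _]addrCA addrCA (addrCA (l *: _) (j *: _)) (addrCA (k *: _) (j *: _)).
Qed.

Fact umul1l : left_id uone umul.
Proof. by move=> [k a]; rewrite /umul /= mul1r scale1r scaler0 cmul0l !addr0. Qed.

Fact umul1r : right_id uone umul.
Proof. by move=> [k a]; rewrite /umul /= mulr1 scale1r scaler0 cmul0r addr0 add0r. Qed.

Fact umulDl : left_distributive umul +%R.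
Proof.
move=> [k a] [l b] [j c]; rewrite /umul /=; congr (_, _); first exact: mulrDl.
by rewrite /= scalerDl scalerDr cmulDl (addrACA (k *: c)) [LHS]addrACA.
Qed.

Fact umulDr : right_distributive umul +%R.
Proof.
move=> [k a] [l b] [j c]; rewrite /umul /=; congr (_, _); first exact: mulrDr.
by rewrite /= scalerDl scalerDr cmulDr (addrACA (k *: b)) [LHS]addrACA.
Qed.

Fact uone_neq0 : uone != 0.
Proof. by apply/eqP => -[] /eqP; rewrite oner_eq0. Qed.

HB.instance Definition _ := GRing.Zmodule_isNzRing.Build unitization
  umulA umul1l umul1r umulDl umulDr uone_neq0.

Fact uscaleAl k m n : k *: (m * n) = (k *: m) * n.
Proof.
case: m n => [l a] [j b]; congr (_, _); first exact: mulrA.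
by rewrite /= !scalerDr !scalerA cmulZl (mulrC k j).
Qed.

HB.instance Definition _ := GRing.Lmodule_isLalgebra.Build R[i] unitization uscaleAl.

Fact uscaleAr k m n : k *: (m * n) = m * (k *: n).
Proof.
case: m n => [l a] [j b]; congr (_, _); first exact: mulrCA.
by rewrite /= !scalerDr !scalerA cmulZr (mulrC k l).
Qed.

HB.instance Definition _ := GRing.Lalgebra_isAlgebra.Build R[i] unitization uscaleAr.

(* The unitization acts on A by left multiplication and is normed as an algebra
   of operators, which makes sense (as a seminorm) even if A is unital. *)
Definition uact m z : A := (m.1 : R[i]) *: z + m.2 ** z.
Definition uadj m : unitization := ((m.1 : R[i])^*, star m.2).
Definition uball m := [set nrm (uact m z) | z in [set z | nrm z <= 1]].
Definition unorm m : R := sup (uball m).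

Lemma uactM m n z : uact (m * n) z = uact m (uact n z).
Proof.
rewrite /uact /= !scalerDr !cmulDl !cmulDr !cmulZl !cmulZr !scalerA cmulA.
by rewrite (mulrC m.1) -!addrA.
Qed.

Lemma uactD m n z : uact (m + n) z = uact m z + uact n z.
Proof. by rewrite /uact /= scalerDl cmulDl addrACA. Qed.

Lemma uactZ k m z : uact (k *: m) z = k *: uact m z.
Proof. by rewrite /uact /= scalerDr scalerA cmulZl. Qed.

Lemma uactZr k m z : uact m (k *: z) = k *: uact m z.
Proof. by rewrite /uact /= scalerDr !scalerA cmulZr mulrC. Qed.

(** Adjointness for the [A]-valued pairing [star z ** w], which stands in for an inner product in
    [unorm_adjM]. *)
Lemma star_uact m z w : star (uact m z) ** w = star z ** uact (uadj m) w.
Proof. by rewrite /uact /= starD starZ starM cmulDl cmulDr cmulZl cmulZr cmulA. Qed.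

Lemma uball_has_sup m : has_sup (uball m).
Proof.
split; first by exists (nrm (uact m 0)), 0; rewrite //= nrm0.
exists (cabs (m.1 : R[i]) + nrm m.2) => _ [z /= z1 <-].
apply: le_trans (nrmD _ _) _; rewrite nrmZ.
have M0 : 0 <= cabs (m.1 : R[i]) := cabs_ge0 _.
apply: lerD; first by rewrite ler_piMr.
by apply: le_trans (nrmM _ _) _; rewrite ler_piMr ?nrm_ge0.
Qed.

Lemma unorm_ge0 m : 0 <= unorm m.
Proof.
apply: le_trans (nrm_ge0 (uact m 0)) _.
by apply: ub_le_sup; [exact: (uball_has_sup m).2|exists 0; rewrite //= nrm0].
Qed.

Lemma unorm_le m (c : R) : 0 <= c -> (forall z, nrm (uact m z) <= c * nrm z) ->
  unorm m <= c.
Proof.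
move=> c0 H; apply: ge_sup; first exact: (uball_has_sup m).1.
by move=> _ [z /= z1 <-]; apply: le_trans (H z) _; rewrite ler_piMr.
Qed.

Lemma nrm_uact m z : nrm (uact m z) <= unorm m * nrm z.
Proof.
have [z0|z0] := eqVneq (nrm z) 0.
  by rewrite (nrm0_eq0 z0) /uact scaler0 cmul0r addr0 nrm0 mulr0.
have zp : 0 < nrm z by rewrite lt_neqAle eq_sym z0 nrm_ge0.
pose y := ((nrm z)^-1)%:C *: z.
have y1 : nrm y <= 1.
  by rewrite nrmZ cabs_real gtr0_norm ?invr_gt0 // mulVf.
have : nrm (uact m y) <= unorm m.
  by apply: ub_le_sup; [exact: (uball_has_sup m).2|exists y].
rewrite uactZr nrmZ cabs_real gtr0_norm ?invr_gt0 //.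
by rewrite mulrC ler_pdivrMr.
Qed.

Fact uadjD : {morph uadj : m n / m + n}.
Proof. by move=> [k a] [l b]; congr (_, _); [exact: rmorphD|exact: starD]. Qed.

Fact uadjZ k m : uadj (k *: m) = k^* *: uadj m.
Proof. by case: m => [l a]; congr (_, _); [exact: rmorphM|exact: starZ]. Qed.

Fact uadjM m n : uadj (m * n) = uadj n * uadj m.
Proof.
case: m n => [k a] [l b]; congr (_, _); first by rewrite /= rmorphM mulrC.
by rewrite /= !starD !starZ starM [X in X + _]addrC.
Qed.

Fact uadjK : involutive uadj.
Proof. by move=> [k a]; congr (_, _); [exact: conjCK|exact: starK]. Qed.

Fact unormD m n : unorm (m + n) <= unorm m + unorm n.
Proof.
apply: unorm_le => [|z]; first by rewrite addr_ge0 ?unorm_ge0.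
rewrite uactD mulrDl; apply: le_trans (nrmD _ _) _.
by apply: lerD; exact: nrm_uact.
Qed.

Fact unormM m n : unorm (m * n) <= unorm m * unorm n.
Proof.
apply: unorm_le => [|z]; first by rewrite mulr_ge0 ?unorm_ge0.
rewrite uactM -mulrA; apply: le_trans (nrm_uact _ _) _.
by apply: ler_wpM2l; [exact: unorm_ge0|exact: nrm_uact].
Qed.

Fact unormZ k m : unorm (k *: m) = cabs k * unorm m.
Proof.
have k0 := @cabs_ge0 R.
have le l n : unorm (l *: n) <= cabs l * unorm n.
  apply: unorm_le => [|z]; first by rewrite mulr_ge0 ?unorm_ge0.
  by rewrite uactZ nrmZ -mulrA ler_wpM2l // nrm_uact.
apply/eqP; rewrite eq_le le andTb.
have [->|kn0] := eqVneq k 0; first by rewrite /cabs normr0 mul0r unorm_ge0.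
have := le k^-1 (k *: m); rewrite scalerA mulVf // scale1r.
move=> H; apply: (@le_trans _ _ (cabs k * (cabs k^-1 * unorm (k *: m)))).
  by rewrite ler_wpM2l.
rewrite mulrA; suff -> : cabs k * cabs k^-1 = 1 by rewrite mul1r.
apply/complexI; rewrite rmorphM /= -!cabsE normfV mulfV //.
by rewrite normr_eq0.
Qed.

Fact unorm_adjM m : unorm (uadj m * m) = unorm m ^+ 2.
Proof.
have ge n : unorm n ^+ 2 <= unorm (uadj n * n).
  rewrite -[X in _ <= X]sqr_sqrtr ?unorm_ge0 // ler_pXn2r ?nnegrE ?sqrtr_ge0 ?unorm_ge0 //.
  apply: unorm_le => [|z]; first exact: sqrtr_ge0.
  rewrite -(@ler_pXn2r _ 2) ?nnegrE ?mulr_ge0 ?sqrtr_ge0 ?nrm_ge0 //.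
  rewrite exprMn sqr_sqrtr ?unorm_ge0 // -nrm_star_mul.
  rewrite star_uact -uactM.
  apply: le_trans (nrmM _ _) _; rewrite nrm_star expr2 mulrA [X in _ <= X]mulrC.
  by rewrite ler_wpM2l ?nrm_ge0 // nrm_uact.
have adj_le n : unorm n <= unorm (uadj n).
  have [->|n0] := eqVneq (unorm n) 0; first exact: unorm_ge0.
  have np : 0 < unorm n by rewrite lt_neqAle eq_sym n0 unorm_ge0.
  by rewrite -(ler_pM2r np) -expr2; apply: le_trans (ge n) _; exact: unormM.
apply/eqP; rewrite eq_le ge andbT; apply: le_trans (unormM _ _) _.
by rewrite expr2 ler_wpM2r ?unorm_ge0 // -{2}(uadjK m) adj_le.
Qed.

Fact unorm1 : unorm 1 <= 1.
Proof.
apply: unorm_le => // z.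
by rewrite /uact /= scale1r cmul0l addr0 mul1r.
Qed.

HB.instance Definition _ := isCStarSeminormed.Build R unitization
  uadjD uadjZ uadjM uadjK unorm_ge0 unormD unormZ unormM unorm_adjM unorm1.

Definition uinj a : unitization := (0, a).

Lemma uinjD a b : uinj (a + b) = uinj a + uinj b.
Proof. by congr (_, _); rewrite addr0. Qed.

Lemma uinjZ k a : uinj (k *: a) = k *: uinj a.
Proof. by congr (_, _); rewrite /= ?scaler0. Qed.

Lemma uinjM a b : uinj (a ** b) = uinj a * uinj b.
Proof. by congr (_, _); rewrite /= ?mul0r // !scale0r !add0r. Qed.

Lemma uinjN a : uinj (- a) = - uinj a.
Proof. by congr (_, _); rewrite oppr0. Qed.

Lemma uinjB a b : uinj (a - b) = uinj a - uinj b.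
Proof. by rewrite uinjD uinjN. Qed.

Lemma uinj_star a : adj (uinj a) = uinj (star a).
Proof. by congr (_, _); rewrite /= conjC0. Qed.

Lemma uinj_inj : injective uinj.
Proof. by move=> a b []. Qed.

Lemma uinj_sum (n : nat) (F : 'I_n -> A) : uinj (\sum_i F i) = \sum_i uinj (F i).
Proof. by apply: (big_morph uinj uinjD); congr (_, _). Qed.

(** Left multiplication by [a] reaches its norm at [star a], by the C*-identity. *)
Lemma opnorm_uinj a : opnorm (uinj a) = nrm a.
Proof.
apply/eqP; rewrite eq_le; apply/andP; split.
  apply: unorm_le => [|z]; first exact: nrm_ge0.
  by rewrite /uact /= scale0r add0r nrmM.
have [->|a0] := eqVneq (nrm a) 0; first exact: opnorm_ge0.
have ap : 0 < nrm a by rewrite lt_neqAle eq_sym a0 nrm_ge0.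
have := nrm_uact (uinj a) (star a).
rewrite /uact /= scale0r add0r -{1}(starK a) nrm_star_mul nrm_star expr2.
by rewrite ler_pM2r.
Qed.

End Unitization.

(** Expand [adj (c + y) * (c + y)]: the terms of first order in [y] are [c * y] and its adjoint, so
    they are negligible once [c * y] is small. *)
Lemma opnormD_sqr_le (R : realType) (U : cstarSeminormedType R) (c y : U) :
  adj c = c -> opnorm c <= 1 ->
  opnorm (c + y) ^+ 2 <= 1 + 2 * opnorm (c * y) + opnorm y ^+ 2.
Proof.
move=> cc c1; rewrite -opnorm_adjM.
have -> : adj (c + y) * (c + y) = c * c + c * y + adj (c * y) + adj y * y.
  by rewrite adjD adjM cc; ncring.
apply: le_trans (opnormD _ _) _; rewrite -opnorm_adjM; apply: lerD => //.
apply: le_trans (opnormD _ _) _; rewrite opnorm_adj.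
have := opnormD (c * c) (c * y); have := opnorm_mul_le c1 c1; lra.
Qed.

(** * Contractive functionals that attain 1 at a positive contraction *)

Section ContractiveFunctionals.
Variables (R : realType) (A : cstarAlgType R).
Implicit Types (f g : A -> R[i]) (a b e z : A) (k : R[i]) (s : R).

Definition contraction f := scalar f /\ forall x, cabs (f x) <= nrm x.

Definition peak e := pos (uinj e) /\ nrm e <= 1.

Lemma scalarPD f a b : scalar f -> f (a + b) = f a + f b.
Proof. by move=> lf; have := lf 1 a b; rewrite scale1r mul1r. Qed.

Lemma scalarP0 f : scalar f -> f 0 = 0.
Proof. by move=> lf; apply: (addrI (f 0)); rewrite -scalarPD // !addr0. Qed.

Lemma scalarPZ f k a : scalar f -> f (k *: a) = k * f a.
Proof. by move=> lf; have := lf k a 0; rewrite scalarP0 // !addr0. Qed.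

Lemma scalarPB f a b : scalar f -> f (a - b) = f a - f b.
Proof. by move=> lf; rewrite -scaleN1r scalarPD // scalarPZ // mulN1r. Qed.

Lemma scalarP_sum f n (F : 'I_n -> A) : scalar f ->
  f (\sum_i F i) = \sum_i f (F i).
Proof.
move=> lf; apply: (big_morph f); last exact: scalarP0.
by move=> a b; exact: scalarPD.
Qed.

(** By [opnorm_join_le1] both [f (a ** b)] and [2 - f (a ** b)] have modulus at most 1. *)
Lemma contraction_mul_eq1 f a b : contraction f -> peak a -> peak b ->
  a ** b = b ** a -> f a = 1 -> f b = 1 -> f (a ** b) = 1.
Proof.
move=> [lf cf] [pa a1] [pb b1] ab fa fb.
have ab1 : nrm (a + b - a ** b) <= 1.
  rewrite -opnorm_uinj uinjB uinjD uinjM.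
  apply: opnorm_join_le1; rewrite ?opnorm_uinj //.
  by rewrite /GRing.comm -!uinjM ab.
have := le_trans (cf _) ab1.
rewrite scalarPB // scalarPD // fa fb => z1.
have z2 : cabs (f (a ** b)) <= 1.
  apply: le_trans (cf _) _; apply: le_trans (nrmM _ _) _.
  by rewrite mulr_ile1 ?nrm_ge0.
apply: complex_eq1 (z2) => //; apply/eqP; rewrite eq_le; apply/andP; split.
  by apply: le_trans z2; apply: le_trans (Re_le_cabs _); exact: ler_norm.
have := le_trans (Re_le_cabs _) z1; rewrite ler_norml => /andP[_].
by rewrite raddfB raddfD /=; lra.
Qed.

(* [cpow a n] is the power n + 1 of a. *)
Definition cpow a n := iter n (cmul a) a.

Definition cesaro a n : A := (n.+1%:R^-1)%:C *: \sum_(i < n.+1) cpow a i.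

Lemma uinj_cpow a n : uinj (cpow a n) = uinj a ^+ n.+1.
Proof. by elim: n => [|n IH]; rewrite ?expr1 // exprS -IH -uinjM. Qed.

Lemma uinj_cesaro a n :
  uinj (cesaro a n) = (n.+1%:R^-1)%:C *: \sum_(i < n.+1) uinj a ^+ i.+1.
Proof.
rewrite uinjZ uinj_sum; congr (_ *: _).
by apply: eq_bigr => i _; rewrite uinj_cpow.
Qed.

Lemma peak_cpow a n : peak a -> peak (cpow a n).
Proof.
move=> [pa a1]; split; first by rewrite uinj_cpow; exact: posX.
rewrite -opnorm_uinj uinj_cpow -(expr1n _ n.+1); apply: opnormX.
by rewrite opnorm_uinj.
Qed.

(** A long enough Cesaro mean of powers of [a] works; [contraction_mul_eq1] gives [f] the value 1 at
    each power. The same [c] serves all [f]. *)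
Lemma cesaro_approx a s : peak a -> 0 < s -> exists c,
  [/\ peak c, a ** c = c ** a, nrm (c - a ** c) <= s
    & forall f, contraction f -> f a = 1 -> f c = 1].
Proof.
move=> [pa a1] s0.
have := archi_boundP (ltW (divr_gt0 (ltr0n R 2) s0)); set n := Num.bound _ => ns.
exists (cesaro a n).
have n0 : 0 < n.+1%:R :> R by rewrite ltr0n.
have a1' : opnorm (uinj a) <= 1 by rewrite opnorm_uinj.
have [c1 c2] := opnorm_cesaro n a1'.
split.
- split; last by rewrite -opnorm_uinj uinj_cesaro.
  rewrite uinj_cesaro; apply: posZ; first by rewrite invr_ge0.
  by apply: pos_sum => i; exact: posX.
- apply: uinj_inj; rewrite !uinjM uinj_cesaro.
  apply: comm_scale; apply: commr_sum => i _.
  exact/commrX/commr_refl.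
- rewrite -opnorm_uinj uinjB uinjM uinj_cesaro; apply: le_trans c2 _.
  rewrite ler_pdivrMr // -ler_pdivrMl // mulrC; apply: ltW.
  by apply: lt_trans ns _; rewrite ltr_nat.
- move=> f cf fa; have fp i : f (cpow a i) = 1.
    elim: i => [//|i IH]; apply: contraction_mul_eq1 => //.
      exact: peak_cpow.
    by apply: uinj_inj; rewrite !uinjM uinj_cpow -exprS exprSr.
  have lf := cf.1.
  rewrite /cesaro scalarPZ // scalarP_sum // (eq_bigr (fun=> 1)) //.
  rewrite sumr_const card_ord -(rmorph_nat (real_complex R)) -rmorphM /=.
  by rewrite mulVf ?gt_eqF.
Qed.

(* With c a Cesaro mean of the powers of e and y = z - e z, c y is small, so
   |f (c + s y)|^2 <= |c + s y|^2 reads (1 + s Re (f y))^2 <= 1 + o(s). *)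
Lemma contraction_absorb_le f e z : contraction f -> peak e -> f e = 1 ->
  complex.Re (f (z - e ** z)) <= 0.
Proof.
move=> cf pe fe; have [lf nf] := cf; have [pe' e1] := pe.
apply/ler_addgt0Pr => d d0; rewrite add0r.
pose M := nrm z + 1; have M1 : 1 <= M by rewrite lerDr nrm_ge0.
pose y := z - e ** z.
have yM : nrm y <= 2 * M.
  rewrite -opnorm_uinj uinjB uinjM; apply: le_trans (opnormB _ _) _.
  have := opnorm_mul_le (lexx (opnorm (uinj e))) (lexx (opnorm (uinj z))).
  have := nrm_ge0 z; have := nrm_ge0 e.
  by rewrite !opnorm_uinj /M; nra.
(* Since [c ** y = (c - e ** c) ** z], its norm is at most [t * M = d / 2]. *)
pose t := d / 2 / M; have t0 : 0 < t by rewrite !divr_gt0 //; lra.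
(* This makes the second-order term [s^2 (2 M)^2] equal to [s * d]. *)
pose s := d / (4 * M ^+ 2).
have s0 : 0 < s by rewrite divr_gt0 // mulr_gt0 // exprn_gt0 //; lra.
have [c [[pc c1] ec cN fc]] := cesaro_approx pe t0.
have cy : nrm (c ** y) <= d / 2.
  have -> : d / 2 = t * M by rewrite /t divfK // gt_eqF //; lra.
  rewrite -opnorm_uinj.
  have -> : uinj (c ** y) = (uinj (c - e ** c)) * uinj z.
    by rewrite ec !(uinjM, uinjB); ncring.
  by apply: opnorm_mul_le; rewrite opnorm_uinj // /M lerDl.
have key : (1 + s * complex.Re (f y)) ^+ 2 <= 1 + s * d + s ^+ 2 * (2 * M) ^+ 2.
  have -> : 1 + s * complex.Re (f y) = complex.Re (f (c + s%:C *: y)).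
    rewrite scalarPD // scalarPZ // fc //.
    by case: (f y) => u v /=; rewrite mul0r subr0.
  apply: (@le_trans _ _ (nrm (c + s%:C *: y) ^+ 2)).
    rewrite -real_normK ?num_real // ler_pXn2r ?nnegrE ?nrm_ge0 //.
    by apply: le_trans (Re_le_cabs _) _.
  rewrite -opnorm_uinj uinjD uinjZ.
  apply: le_trans (opnormD_sqr_le _ _ _) _; rewrite ?opnorm_uinj //.
    exact: pc.1.
  rewrite -scalerAr !opnormR (gtr0_norm s0) -uinjM !opnorm_uinj exprMn.
  apply: lerD; last first.
    by rewrite ler_pM2l ?exprn_gt0 // ler_pXn2r ?nnegrE ?nrm_ge0 //; lra.
  by rewrite lerD2l; move: cy s0; nra.
have sM : s * (2 * M) ^+ 2 = d.
  by rewrite /s; field; rewrite gt_eqF //; lra.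
have : s * (complex.Re (f y)) * 2 <= s * (d * 2).
  have := sqr_ge0 (s * complex.Re (f y)).
  have : s ^+ 2 * (2 * M) ^+ 2 = s * d by rewrite expr2 -mulrA sM.
  move: key; rewrite -/y; lra.
by rewrite -mulrA ler_pM2l //; lra.
Qed.

(** Apply the one-sided bound to [z] multiplied by 1, -1, i and -i. *)
Lemma contraction_absorbl f e z : contraction f -> peak e -> f e = 1 ->
  f (e ** z) = f z.
Proof.
move=> cf pe fe; have lf := cf.1.
have H y k : complex.Re (k * f (y - e ** y)) <= 0.
  rewrite -scalarPZ // scalerBr -cmulZr; exact: contraction_absorb_le.
apply/eqP; rewrite eq_sym -subr_eq0 -scalarPB //; apply/eqP.
move: (H z 1) (H z (-1)) (H z 'i%C) (H z (- 'i%C)).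
case: (f (z - e ** z)) => u v /=.
rewrite !(mul0r, mul1r, mulN1r, oppr0, subr0, sub0r, opprK, oppr_le0).
move=> u0 u1 v0 v1; apply/eqP; rewrite eq_complex /=.
by apply/andP; split; apply/eqP; lra.
Qed.

(** This conjugate functional turns absorption on the left into absorption on the right. *)
Lemma contraction_adj f : contraction f -> contraction (fun x => (f (star x))^*).
Proof.
move=> [lf nf]; split=> [k x y|x].
  by rewrite starD starZ scalarPD // scalarPZ // rmorphD rmorphM /= conjCK.
by rewrite /= cabs_conj -(nrm_star x).
Qed.

Lemma contraction_absorbr f e z : contraction f -> peak e -> f e = 1 ->
  f (z ** e) = f z.
Proof.
move=> cf pe fe.
have es : star e = e by apply: uinj_inj; rewrite -uinj_star; exact: pe.1.1.
have := @contraction_absorbl _ e (star z) (contraction_adj cf) pe.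
rewrite starM starK es fe conjC1 => /(_ erefl) H.
exact: (can_inj (@conjCK _)).
Qed.

Lemma peak_star_mul a : nrm (star a ** a) <= 1 -> peak (star a ** a).
Proof.
by move=> a1; split=> //; rewrite uinjM -uinj_star; exact: pos_adj_mul.
Qed.

(** Absorption of [e] gives [f (k *: e + x ** e) = k + f x], so [f] acts as if extended
    contractively to [k *: 1 + uinj x]. Taking [k = - r] bounds the real part of [f x] below by 0;
    imaginary [k] excludes an imaginary part. *)
Lemma contraction_positive f e : contraction f -> peak e -> f e = 1 ->
  positive_fun f.
Proof.
move=> cf pe fe _ [y ->]; have [lf nf] := cf; have [pe' e1] := pe.
set x := star y ** y; pose r := nrm x.
have px : pos (uinj x) by rewrite uinjM -uinj_star; exact: pos_adj_mul.
have fE k : f (k *: e + x ** e) = k + f x.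
  by rewrite scalarPD // scalarPZ // fe mulr1 contraction_absorbr.
have fN k : cabs (k + f x) <= opnorm (k *: 1 + uinj x).
  rewrite -fE; apply: le_trans (nf _) _; rewrite -opnorm_uinj uinjD uinjZ uinjM.
  have -> : k *: uinj e + uinj x * uinj e = (k *: 1 + uinj x) * uinj e.
    by rewrite mulrDl -scalerAl mul1r.
  rewrite -[X in _ <= X]mulr1; apply: opnorm_mul_le; rewrite ?opnorm_uinj //.
have r0 : 0 <= r := nrm_ge0 x.
have Re0 : 0 <= complex.Re (f x).
  have H : cabs (- r%:C + f x) <= r.
    apply: le_trans (fN _) _.
    have -> : (- r%:C) *: 1 + uinj x = - (r%:C *: 1 - uinj x) by rewrite scaleNr opprB addrC.
    by rewrite opnormN; apply: pos_opnorm_sub; rewrite ?opnorm_uinj.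
  have := le_trans (Re_le_cabs _) H; rewrite ler_norml => /andP[].
  by case: (f x) => u v /=; lra.
have Im0 t : (t + complex.Im (f x)) ^+ 2 <= t ^+ 2 + r ^+ 2.
  have : cabs ('i * t%:C + f x) ^+ 2 <= t ^+ 2 + r ^+ 2.
    apply: (@le_trans _ _ (opnorm (('i * t%:C) *: 1 + uinj x) ^+ 2)).
      by rewrite ler_pXn2r ?nnegrE ?cabs_ge0 ?opnorm_ge0.
    rewrite -opnorm_adjM adjD adjZ adj1 (px.1) rmorphM /= conjCi conj_real_complex.
    have -> : ((- 'i * t%:C) *: 1 + uinj x) * (('i * t%:C) *: 1 + uinj x) =
        (t ^+ 2)%:C *: 1 + uinj x * uinj x.
      rewrite mulNr scaleNr mulrDl !mulrDr !mulNr -!scalerAl -!scalerAr !mul1r !mulr1.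
      rewrite scalerA mulrACA -['i * 'i]expr2 sqrCi mulN1r scaleNr opprK.
      by rewrite -rmorphM -expr2 /=; ncring.
    apply: le_trans (opnormD _ _) _; apply: lerD.
      by apply: le_trans (opnorm_scal _ _) _; rewrite ger0_norm ?sqr_ge0.
    by rewrite expr2; apply: opnorm_mul_le; rewrite opnorm_uinj.
  rewrite cabs_sqr; apply: le_trans; rewrite -[X in X <= _]add0r.
  apply: lerD; first exact: sqr_ge0.
  suff -> : complex.Im ('i * t%:C + f x) = t + complex.Im (f x) by [].
  by case: (f x) => u v /=; rewrite mul1r mul0r add0r.
rewrite lecE /= Re0 andbT; apply/eqP; apply: contrapT => /eqP v0.
(* With [v] the imaginary part and [t = r^2 / v], the bound reads [2 r^2 + v^2 <= r^2], which is
   absurd. *)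
have := Im0 (r ^+ 2 / complex.Im (f x)); rewrite sqrrD.
rewrite divfK // mulr2n; have : 0 < complex.Im (f x) ^+ 2 by rewrite exprn_even_gt0.
have := sqr_ge0 r; lra.
Qed.

Lemma state_contraction f : state f -> contraction f.
Proof.
move=> [lf _ nf]; split=> // x.
have H y : nrm y <= 1 -> cabs (f y) <= 1.
  move=> y1; rewrite -lee_fin -nf; apply: ereal_sup_ubound; exists y => //=.
  by rewrite nrmE lecR.
have [x0|x0] := eqVneq (nrm x) 0.
  by rewrite (nrm0_eq0 x0) scalarP0 // nrm0 /cabs normr0.
have xp : 0 < nrm x by rewrite lt_neqAle eq_sym x0 nrm_ge0.
have := H ((nrm x)^-1%:C *: x).
rewrite nrmZ cabs_real gtr0_norm ?invr_gt0 // mulVf // => /(_ (lexx _)).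
rewrite scalarPZ // cabsM cabs_real gtr0_norm ?invr_gt0 //.
by rewrite mulrC ler_pdivrMr // mul1r.
Qed.

Lemma fun_norm_contraction f e : contraction f -> nrm e <= 1 -> f e = 1 ->
  fun_norm f = 1%E.
Proof.
move=> [lf nf] e1 fe; apply/eqP; rewrite eq_le; apply/andP; split.
  apply: ge_ereal_sup => _ [x /= x1 <-]; rewrite lee_fin.
  by apply: le_trans (nf x) _; move: x1; rewrite nrmE lecR.
apply: ereal_sup_ubound; exists e; first by rewrite /= nrmE lecR.
by rewrite fe normr1.
Qed.

Lemma contraction_state f e : contraction f -> peak e -> f e = 1 -> state f.
Proof.
move=> cf pe fe; split; first exact: cf.1.
- exact: contraction_positive fe.
- exact: (fun_norm_contraction cf pe.2).
Qed.

End ContractiveFunctionals.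

(** Insert [f] next to [a] on both sides: each insertion costs [t * opnorm a], and the middle term
    inherits the error [s]. *)
Lemma opnorm_recompress (R : realType) (U : cstarSeminormedType R)
    (c f a d : U) (s t : R) :
  opnorm c <= 1 -> opnorm f <= 1 ->
  opnorm (c - f * c) <= t -> opnorm (c - c * f) <= t ->
  opnorm (f * a * f - d) <= s ->
  opnorm (c * a * c - c * d * c) <= s + 2 * t * opnorm a.
Proof.
move=> c1 f1 fc cf fad.
have -> : c * a * c - c * d * c =
  (c - c * f) * a * c + c * f * a * (c - f * c) + c * (f * a * f - d) * c by ncring.
apply: le_trans (opnormD _ _) _; rewrite [s + _]addrC; apply: lerD; last first.
  rewrite -[s]mulr1 -[s]mul1r; apply: opnorm_mul_le => //.
  exact: opnorm_mul_le.
have -> : 2 * t * opnorm a = t * opnorm a * 1 + 1 * 1 * opnorm a * t by ring.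
apply: le_trans (opnormD _ _) _; apply: lerD.
  by do 2!apply: opnorm_mul_le => //.
by do 3!apply: opnorm_mul_le => //.
Qed.

(** * Compressions and the extension that they define *)

Section Compression.
Variables (R : realType) (A : cstarAlgType R) (B : cstarSubalg A).
Variable phi : subalg_type B -> R[i].
Hypothesis phi_contraction : contraction phi.
Implicit Types (a : A) (f c : subalg_type B) (r s t : R).

Lemma val_cmul f c : \val (f ** c) = \val f ** \val c. Proof. by []. Qed.

Lemma nrm_val f : nrm (\val f) = nrm f. Proof. by []. Qed.

Definition compresses a f c s :=
  [/\ peak f, phi f = 1 & nrm (\val f ** a ** \val f - \val c) <= s].

Lemma compresses_common a1 a2 f1 f2 c1 c2 s1 s2 t : 0 < t ->
  compresses a1 f1 c1 s1 -> compresses a2 f2 c2 s2 ->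
  exists f, [/\ compresses a1 f (f ** c1 ** f) (s1 + t),
    compresses a2 f (f ** c2 ** f) (s2 + t),
    phi (f ** c1 ** f) = phi c1 & phi (f ** c2 ** f) = phi c2].
Proof.
move=> t0 [[p1 n1] e1 v1] [[p2 n2] e2 v2].
have [lphi nphi] := phi_contraction.
pose e := ((2^-1 : R)%:C : R[i]) *: (f1 + f2).
have uE : uinj e = (2^-1)%:C *: (uinj f1 + uinj f2) by rewrite uinjZ uinjD.
have pe : peak e.
  split; first by rewrite uE; apply: posZ; [rewrite invr_ge0|exact: posD].
  rewrite nrmZ cabs_real ger0_norm ?invr_ge0 //.
  by have := nrmD f1 f2; lra.
have fe : phi e = 1.
  rewrite scalarPZ // scalarPD // e1 e2.
  by rewrite -(rmorphD (real_complex R) 1 1) -rmorphM /= mulVf.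
pose M := nrm a1 + nrm a2 + 1.
have M0 : 0 < M by rewrite ltr_wpDl // addr_ge0 ?nrm_ge0.
(* Recompression adds [2 * q * opnorm (uinj a)], at most [2 * q * M = t]. The mean must be absorbed
   up to [q^2 / 2] because [opnorm_mean_sub] bounds a square. *)
pose q := t / (2 * M); have q0 : 0 < q by rewrite divr_gt0 // mulr_gt0.
have d0 : 0 < q ^+ 2 / 2 by rewrite divr_gt0 ?exprn_gt0.
have [f [pf ef fN ff]] := cesaro_approx pe d0.
have ff1 := ff _ phi_contraction fe.
have adjf : adj (uinj f) = uinj f by exact: pf.1.1.
have fN' : 2 * opnorm (uinj f - uinj e * uinj f) <= q ^+ 2.
  by rewrite -uinjM -uinjB opnorm_uinj; lra.
have near g : peak g -> opnorm (uinj f - uinj g * uinj f) ^+ 2 <= q ^+ 2 ->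
    nrm (f - g ** f) <= q /\ nrm (f - f ** g) <= q.
  move=> pg; rewrite ler_pXn2r ?nnegrE ?opnorm_ge0 //; last exact: ltW.
  move=> H.
  split; first by rewrite -opnorm_uinj uinjB uinjM.
  rewrite -opnorm_uinj uinjB uinjM -opnorm_adj adjB adjM adjf pg.1.1 //.
have [g1 h1] : nrm (f - f1 ** f) <= q /\ nrm (f - f ** f1) <= q.
  apply: (near f1 (conj p1 n1)); apply: le_trans fN'; rewrite uE.
  by apply: opnorm_mean_sub; rewrite ?opnorm_uinj // ?pf.2.
have [g2 h2] : nrm (f - f2 ** f) <= q /\ nrm (f - f ** f2) <= q.
  apply: (near f2 (conj p2 n2)); apply: le_trans fN'; rewrite uE (addrC (uinj f1)).
  by apply: opnorm_mean_sub; rewrite ?opnorm_uinj // ?pf.2.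
have absorb c : phi (f ** c ** f) = phi c.
  by rewrite contraction_absorbr // contraction_absorbl.
have comp a g c s : nrm a <= M -> nrm g <= 1 -> nrm (f - g ** f) <= q ->
    nrm (f - f ** g) <= q -> nrm (\val g ** a ** \val g - \val c) <= s ->
    compresses a f (f ** c ** f) (s + t).
  move=> aM g'1 gf fg gac; split=> //.
  rewrite !val_cmul -opnorm_uinj uinjB !uinjM.
  apply: (@le_trans _ _ (s + 2 * q * opnorm (uinj a))).
    apply: (@opnorm_recompress _ _ _ (uinj (\val g))).
    - by rewrite opnorm_uinj; exact: pf.2.
    - by rewrite opnorm_uinj.
    - by rewrite -uinjM -uinjB opnorm_uinj.
    - by rewrite -uinjM -uinjB opnorm_uinj.
    - by rewrite -!uinjM -uinjB opnorm_uinj.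
  rewrite lerD2l opnorm_uinj.
  have -> : t = 2 * q * M by rewrite /q; field; rewrite gt_eqF.
  by rewrite ler_wpM2l // mulr_ge0 // ltW.
exists f; split => //.
  by apply: comp v1; rewrite // /M; have := nrm_ge0 a2; lra.
by apply: comp v2; rewrite // /M; have := nrm_ge0 a1; lra.
Qed.

(** Over a common [f], both [f ** c1 ** f] and [f ** c2 ** f] lie near [f a f], and [phi] has not
    changed on them. *)
Lemma compresses_dist a f1 f2 c1 c2 s1 s2 :
  compresses a f1 c1 s1 -> compresses a f2 c2 s2 ->
  cabs (phi c1 - phi c2) <= s1 + s2.
Proof.
move=> v1 v2; apply/ler_addgt0Pr => t t0.
have t2 : 0 < t / 2 by lra.
have [f [[_ _ w1] [_ _ w2] <- <-]] := compresses_common t2 v1 v2.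
rewrite -scalarPB; last exact: phi_contraction.1.
apply: le_trans (phi_contraction.2 _) _.
rewrite -nrm_val -opnorm_uinj.
have -> : uinj (\val (f ** c1 ** f - f ** c2 ** f)) =
    uinj (\val f ** a ** \val f - \val (f ** c2 ** f)) -
    uinj (\val f ** a ** \val f - \val (f ** c1 ** f)).
  by rewrite -uinjB; congr uinj; rewrite raddfB opprB [RHS]addrC addrA subrK.
apply: le_trans (opnormB _ _) _; rewrite !opnorm_uinj; lra.
Qed.

(** Over a common [f] the same combination of the compressed elements compresses [k *: a1 + a2];
    then [compresses_dist] compares it with [c3]. *)
Lemma compresses_linear k a1 a2 f1 f2 f3 c1 c2 c3 s1 s2 s3 :
  compresses a1 f1 c1 s1 -> compresses a2 f2 c2 s2 ->
  compresses (k *: a1 + a2) f3 c3 s3 ->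
  cabs (phi c3 - (k * phi c1 + phi c2)) <= s3 + (cabs k * s1 + s2).
Proof.
move=> v1 v2 v3; apply/ler_addgt0Pr => t t0; have lphi := phi_contraction.1.
have k0 := cabs_ge0 k.
have t2 : 0 < t / (cabs k + 1) by rewrite divr_gt0 // ltr_wpDl.
have [f [[pf ff w1] [_ _ w2] <- <-]] := compresses_common t2 v1 v2.
rewrite -scalarPZ // -scalarPD //.
have := compresses_dist v3 (_ : compresses (k *: a1 + a2) f
  (k *: (f ** c1 ** f) + f ** c2 ** f)
  (cabs k * (s1 + t / (cabs k + 1)) + (s2 + t / (cabs k + 1)))).
have -> : s3 + (cabs k * s1 + s2) + t = s3 + (cabs k * (s1 + t / (cabs k + 1)) +
    (s2 + t / (cabs k + 1))).
  by field; rewrite gt_eqF // ltr_wpDl.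
apply; split=> //.
have -> : \val f ** (k *: a1 + a2) ** \val f - \val (k *: (f ** c1 ** f) + f ** c2 ** f) =
    k *: (\val f ** a1 ** \val f - \val (f ** c1 ** f)) +
    (\val f ** a2 ** \val f - \val (f ** c2 ** f)).
  have -> : \val (k *: (f ** c1 ** f) + f ** c2 ** f) =
    k *: \val (f ** c1 ** f) + \val (f ** c2 ** f) by [].
  by rewrite cmulDr cmulDl cmulZr cmulZl scalerBr opprD addrACA.
apply: le_trans (nrmD _ _) _; apply: lerD => //.
by rewrite nrmZ; apply: ler_wpM2l.
Qed.

(** The value [phi b] is nonnegative of modulus 1, hence 1. Positivity is recorded in the
    unitizations of both [B] and [A], each time from [b = star y ** y]. *)
Lemma compressible_approx : compressible_modulo phi ->
  positive_fun phi -> forall a s, 0 < s -> exists b c,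
  compresses a b c s /\ peak (\val b).
Proof.
move=> hc pphi a s s0; have [b [c [[fb nb] [y byy] bac]]] := hc a s s0.
have b1 : nrm b <= 1 by rewrite /nrm nb.
have fb1 : phi b = 1.
  have f0 : 0 <= phi b by apply: pphi; exists y.
  by rewrite -fb ger0_norm.
exists b, c; split.
  split=> //; first by rewrite byy in b1 *; exact: peak_star_mul.
  by rewrite -lecR -nrmE ltW.
have -> : \val b = star (\val y) ** \val y by rewrite byy.
apply: peak_star_mul; rewrite -[X in nrm X]/(\val (star y ** y)) -byy.
exact: b1.
Qed.

Hypothesis approx : forall a s, 0 < s -> exists f c, compresses a f c s.

(** By [compresses_dist] the intervals of radius [s] around the real parts of [phi c] meet pairwise,
    so the supremum of their left ends lies in all of them; likewise for imaginary parts. Adding the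
    two gives [2 * s]. *)
Lemma compression_limit a : exists z : R[i],
  forall f c s, compresses a f c s -> cabs (z - phi c) <= 2 * s.
Proof.
have part (p : R[i] -> R) : (forall z w, p z - p w <= cabs (z - w)) ->
    exists x, forall f c s, compresses a f c s -> `|x - p (phi c)| <= s.
  move=> pL; pose S := [set x | exists f c s, compresses a f c s /\ x = p (phi c) - s].
  have ub f c s : compresses a f c s -> ubound S (p (phi c) + s).
    move=> v _ [f' [c' [s' [v' ->]]]].
    by have := pL (phi c') (phi c); have := compresses_dist v' v; lra.
  have S0 : S !=set0.
    have [f [c v]] := approx a ltr01.
    by exists (p (phi c) - 1), f, c, 1.
  exists (sup S) => f c s v; rewrite ler_norml; apply/andP; split.
    rewrite lerBrDl; apply: ub_le_sup; first by exists (p (phi c) + s); exact: ub v.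
    by exists f, c, s.
  by rewrite lerBlDl; apply: ge_sup => //; exact: ub v.
have [x xP] : exists x, forall f c s, compresses a f c s ->
    `|x - complex.Re (phi c)| <= s.
  by apply: part => z w; rewrite -raddfB; apply: le_trans (Re_le_cabs _); exact: ler_norm.
have [y yP] : exists y, forall f c s, compresses a f c s ->
    `|y - complex.Im (phi c)| <= s.
  by apply: part => z w; rewrite -raddfB; apply: le_trans (Im_le_cabs _); exact: ler_norm.
exists (x +i* y)%C => f c s v; apply: le_trans (cabs_le_ReIm _) _.
have := xP _ _ _ v; have := yP _ _ _ v; case: (phi c) => u w /=; lra.
Qed.

Lemma compression_extension : exists2 psi : A -> R[i], contraction psi &
  forall b, psi (\val b) = phi b.
Proof.
have /choice[psi psiP] := compression_limit.
have lphi := phi_contraction.1.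
exists psi; last first.
  move=> b; have [f [c [pf ff _]]] := approx (\val b) ltr01.
  (* An element of [B] is compressed with error 0, so [psi] takes exactly the value
     [phi (f ** b ** f) = phi b]. *)
  have v : compresses (\val b) f (f ** b ** f) 0.
    by split=> //; rewrite !val_cmul subrr nrm0.
  have := psiP _ _ _ _ v; rewrite mulr0 contraction_absorbr // contraction_absorbl //.
  move=> H; apply/eqP; rewrite -subr_eq0; apply/eqP/cabs0_eq0/eqP.
  by rewrite eq_le H cabs_ge0.
split=> [k a1 a2|a].
  apply/eqP; rewrite -subr_eq0; apply/eqP/cabs0_eq0/eqP.
  rewrite eq_le cabs_ge0 andbT; apply/ler_addgt0Pr => t t0; rewrite add0r.
  have k0 := cabs_ge0 k.
  (* The errors add up to [2 s + (2 + |k|) s + 2 (|k| + 1) s = 3 s (|k| + 2)]. *)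
  pose s := t / (3 * (cabs k + 2)).
  have s0 : 0 < s by rewrite divr_gt0 // mulr_gt0 // ltr_wpDl.
  have st : 3 * s * (cabs k + 2) = t.
    by rewrite /s; field; rewrite gt_eqF // ltr_wpDl.
  have [f1 [c1 v1]] := approx a1 s0; have [f2 [c2 v2]] := approx a2 s0.
  have [f3 [c3 v3]] := approx (k *: a1 + a2) s0.
  have := compresses_linear v1 v2 v3.
  have := psiP _ _ _ _ v1; have := psiP _ _ _ _ v2; have := psiP _ _ _ _ v3.
  have -> : psi (k *: a1 + a2) - (k * psi a1 + psi a2) =
      (psi (k *: a1 + a2) - phi c3) + (phi c3 - (k * phi c1 + phi c2)) -
      (k * (psi a1 - phi c1) + (psi a2 - phi c2)) by ring.
  set x3 := psi _ - phi c3; set y := phi c3 - _.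
  set x1 := psi a1 - _; set x2 := psi a2 - _ => H3 H2 H1 H.
  apply: le_trans (cabsB _ _) _.
  have := cabsD x3 y; have := cabsD (k * x1) x2; rewrite cabsM.
  have : cabs k * cabs x1 <= cabs k * (2 * s) by rewrite ler_wpM2l.
  lra.
apply/ler_addgt0Pr => t t0; have t3 : 0 < t / 3 by lra.
have [f [c [[pf f1] ff v]]] := approx a t3.
have := psiP _ _ _ _ (And3 (conj pf f1) ff v).
have fac : nrm (\val f ** a ** \val f) <= nrm a.
  apply: le_trans (nrmM _ _) _; rewrite -[X in _ <= X]mulr1.
  rewrite ler_pM ?nrm_ge0 //; apply: le_trans (nrmM _ _) _.
  by rewrite ler_piMl ?nrm_ge0.
have cN : nrm c <= nrm a + t / 3.
  rewrite -nrm_val -opnorm_uinj.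
  have -> : uinj (\val c) = uinj (\val f ** a ** \val f) -
      uinj (\val f ** a ** \val f - \val c) by rewrite [in RHS]uinjB; ncring.
  by apply: le_trans (opnormB _ _) _; rewrite !opnorm_uinj; apply: lerD.
have := cabsD (psi a - phi c) (phi c); rewrite subrK.
have := phi_contraction.2 c; lra.
Qed.

End Compression.

(** * Existence, uniqueness and purity of the state extension *)

Theorem theorem5p4 (R : realType) (A : cstarAlgType R) (B : cstarSubalg A)
    (phi : subalg_type B -> R[i]) :
  state phi -> compressible_modulo phi ->
  (exists! psi : A -> R[i], state_extension phi psi) /\
  (pure_state phi ->
     forall psi : A -> R[i], state_extension phi psi -> pure_state psi).
Proof.
move=> sphi hc; have cphi := state_contraction sphi.
have [lphi pphi _] := sphi.
have approx := compressible_approx hc pphi.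
have approx' a s : 0 < s -> exists f c, compresses phi a f c s.
  by move=> /(approx a)[f [c [v _]]]; exists f, c.
(* Compressing 0 serves only to produce a positive contraction [b] of [B] with [phi b = 1]. *)
have [b [_ [[pb fb _] pvb]]] := approx (0 : A) 1 ltr01.
have uniq psi psi' : state_extension phi psi -> state_extension phi psi' ->
    psi = psi'.
  move=> [sp ep] [sp' ep']; apply/funext => a.
  (* Absorption gives [g a = g (f a f)], which is within [t] of [g c = phi c]. *)
  have near g t : state_extension phi g -> forall f c, compresses phi a f c t ->
      peak (\val f) -> cabs (g a - phi c) <= t.
    move=> [sg eg] f c [_ ff v] pf; have cg := state_contraction sg.
    have gf : g (\val f) = 1 by rewrite eg.
    rewrite -(contraction_absorbl a cg pf gf) -(contraction_absorbr _ cg pf gf).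
    rewrite -eg -scalarPB; last exact: cg.1.
    exact: le_trans (cg.2 _) v.
  apply/eqP; rewrite -subr_eq0; apply/eqP/cabs0_eq0/eqP.
  rewrite eq_le cabs_ge0 andbT; apply/ler_addgt0Pr => t t0; rewrite add0r.
  have t2 : 0 < t / 2 by lra.
  have [f [c [v pf]]] := approx a _ t2.
  have := near _ _ (conj sp ep) _ _ v pf; have := near _ _ (conj sp' ep') _ _ v pf.
  have -> : psi a - psi' a = (psi a - phi c) - (psi' a - phi c) by ring.
  by have := cabsB (psi a - phi c) (psi' a - phi c); lra.
split.
  have [psi cpsi epsi] := compression_extension cphi approx'.
  have ext : state_extension phi psi.
    by split=> //; apply: (contraction_state cpsi pvb); rewrite epsi.
  by exists psi; split=> // psi' ext'; exact: uniq.
move=> [_ pure] psi ext; have [sp ep] := ext; split=> // g h t sg sh t01 gh.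
have cg := state_contraction sg; have ch := state_contraction sh.
have /andP[t0 t1] := t01.
have b1 (u : A -> R[i]) : contraction u -> cabs (u (\val b)) <= 1.
  by move=> cu; apply: le_trans (cu.2 _) _; exact: pb.2.
have gb1 := b1 _ cg; have hb1 := b1 _ ch.
(* The two real parts are at most 1 and a proper convex combination of them equals 1. *)
have gh1 : complex.Re (g (\val b)) = 1 /\ complex.Re (h (\val b)) = 1.
  have := gh (\val b); rewrite ep fb => /(congr1 (@complex.Re R)).
  have := le_trans (ler_norm _) (le_trans (Re_le_cabs _) gb1).
  have := le_trans (ler_norm _) (le_trans (Re_le_cabs _) hb1).
  case: (g _) => u v; case: (h _) => u' v' /=; rewrite !mul0r !subr0 => *.
  by split; nra.
(* The value 1 at [b] keeps the norm of the restriction from dropping below 1. *)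
have restr (u : A -> R[i]) : state u -> u (\val b) = 1 ->
    state (fun x : subalg_type B => u (\val x)).
  move=> su ub; have cu := state_contraction su.
  apply: (@contraction_state _ _ _ b) => //; split=> [k x y|x].
    by rewrite linearP; exact: cu.1.
  exact: cu.2.
have gb := complex_eq1 gh1.1 gb1; have hb := complex_eq1 gh1.2 hb1.
have [gE hE] := pure _ _ t (restr _ sg gb) (restr _ sh hb) t01
  (fun x => etrans (esym (ep x)) (gh (\val x))).
by split; apply: uniq => //; split=> // x; [rewrite -gE|rewrite -hE].
Qed.
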